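(* Let $\hat\xi_t\in\mathbb R^{(L+1)n}$, let $\tilde V_t$ be symmetric positive definite, and let $c_t>0$. Define $$\tilde G_t=\tilde A\tilde V_t\tilde C^\top(\tilde C\tilde V_t\tilde C^\top+\tilde D\tilde D^\top)^{-1},\qquad \tilde P_{t+1}=\tilde A\tilde V_t\tilde A^\top-\tilde G_t(\tilde C\tilde V_t\tilde C^\top+\tilde D\tilde D^\top)\tilde G_t^\top+\tilde B\tilde B^\top,$$ and $g_t^0(y)=\tilde A\hat\xi_t+\tilde G_t(y-\tilde C\hat\xi_t)$. Then: (i) the function $$\gamma(\lambda)=\frac12\Big[\mathrm{tr}\big((I-\lambda^{-1}\tilde H^\top\tilde H\tilde P_{t+1})^{-1}-I\big)+\ln\det(I-\lambda^{-1}\tilde H^\top\tilde H\tilde P_{t+1})\Big]$$ is strictly decreasing on $(r(\tilde H\tilde P_{t+1}\tilde H^\top),\infty)$, with $\gamma(\lambda)\to+\infty$ as $\lambda\downarrow r(\tilde H\tilde P_{t+1}\tilde H^\top)$ and $\gamma(\lambda)\to0$ as $\lambda\to\infty$; hence there is a unique $\lambda_t>r(\tilde H\tilde P_{t+1}\tilde H^\top)$ with $\gamma(\lambda_t)=c_t$; (ii) with $\tilde V_{t+1}=(\tilde P_{t+1}^{-1}-\lambda_t^{-1}\tilde H^\top\tilde H)^{-1}$ (positive definite), let $\tilde f_t^0=\mathcal N(m_{z_t\mid Y_{t-1}},\tilde K^0)$ with $$\tilde K^0=\begin{bmatrix}I&\tilde G_t\\0&I\end{bmatrix}\begin{bmatrix}\tilde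 V_{t+1}&0\\0&\tilde C\tilde V_t\tilde C^\top+\tilde D\tilde D^\top\end{bmatrix}\begin{bmatrix}I&0\\ \tilde G_t^\top&I\end{bmatrix};$$ then $\tilde f_t^0\in\bar{\mathcal B}_t$ with $D(\tilde f_t^0\|\bar f_t)=c_t$, $\tilde f^0_t$ is a non-degenerate Gaussian density, and $(g_t^0,\tilde f_t^0)$ is a saddle point of the minimax problem $\min_{g\in\bar{\mathcal G}_t}\max_{\tilde f\in\bar{\mathcal B}_t}J_t(\tilde f,g)$, i.e. $J_t(\tilde f,g_t^0)\le J_t(\tilde f_t^0,g_t^0)\le J_t(\tilde f_t^0,g)$ for all $\tilde f\in\bar{\mathcal B}_t$, $g\in\bar{\mathcal G}_t$; (iii) under $\tilde f_t^0$, the conditional distribution of $\xi_{t+1}$ given $y_t$ is Gaussian with mean $g_t^0(y_t)$ and covariance $\tilde V_{t+1}$, while $\tilde P_{t+1}$ is the corresponding conditional covariance under $\bar f_t$.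
   Context: $A\in\mathbb R^{n\times n}$, $B\in\mathbb R^{n\times(n+m)}$, $C\in\mathbb R^{m\times n}$, $D\in\mathbb R^{m\times(n+m)}$ with $BD^\top=0$, $\mathrm{rank}(B)=n$, $\mathrm{rank}(D)=m$. Fix $L\ge1$. $\tilde A\in\mathbb R^{(L+1)n\times(L+1)n}$ is the block matrix with $A$ in block $(1,1)$, $I_n$ in blocks $(i+1,i)$ for $i=1,\dots,L$, zero blocks elsewhere; $\tilde B=[B^\top\ 0\ \cdots\ 0]^\top$; $\tilde C=[C\ 0\ \cdots\ 0]$; $\tilde D=D$; $\tilde H=[0\ \cdots\ 0\ I_n]\in\mathbb R^{n\times(L+1)n}$. For a symmetric matrix $P$, $r(P)$ is its largest eigenvalue. Write $z_t=[\xi_{t+1}^\top\ y_t^\top]^\top\in\mathbb R^{(L+1)n+m}$. The nominal predictive density is $\bar f_t=\mathcal N(m_{z_t\mid Y_{t-1}},K_{z_t\mid Y_{t-1}})$ with $m_{z_t\mid Y_{t-1}}=[\tilde A^\top\ \tilde C^\top]^\top\hat\xi_t$ and $K_{z_t\mid Y_{t-1}}=[\tilde A^\top\ \tilde C^\top]^\top\tilde V_t[\tilde A^\top\ \tilde C^\top]+[\tilde B^\top\ \tilde D^\top]^\top[\tilde B^\top\ \tilde D^\top]$. The ambiguity set $\bar{\mathcal B}_t$ is the set of probability densities $\tilde f$ on $\mathbb R^{(L+1)n+m}$ with Kullback–Leibler divergence $D(\tilde f\|\bar f_t)=\int\tilde f\ln(\tilde f/\bar f_t)\le c_t$. $\bar{\mathcal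 G}_t$ is the set of measurable estimators $g:\mathbb R^m\to\mathbb R^{(L+1)n}$ with finite second-order moments under every $\tilde f\in\bar{\mathcal B}_t$. The cost is $J_t(\tilde f,g)=\frac12\int\|\tilde H(\xi_{t+1}-g(y_t))\|^2\tilde f(z_t)\,dz_t$. *)

(* Defs.v *)
From HB Require Import structures.
From mathcomp Require Import all_boot all_order all_algebra.
From mathcomp Require Import all_classical all_reals all_analysis.
Set Implicit Arguments. Unset Strict Implicit. Unset Printing Implicit Defensive.
Import Order.TTheory GRing.Theory Num.Theory.
Local Open Scope classical_set_scope.
Local Open Scope ring_scope.

Definition ent {R : nzRingType} a b (M : 'M[R]_(a, b)) (i j : nat) : R :=
  match (insub i : option 'I_a), (insub j : option 'I_b) with
  | Some i', Some j' => M i' j'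
  | _, _ => 0
  end.

Definition posdef {R : realType} N (M : 'M[R]_N) : Prop :=
  M^T = M /\ forall x : 'cV[R]_N, x != 0 -> 0 < (x^T *m M *m x) 0 0.

Definition lmax {R : realType} N (M : 'M[R]_N) : R :=
  sup [set a : R | eigenvalue M a].

Definition sqnorm {R : realType} N (x : 'cV[R]_N) : R := \sum_i (x i 0) ^+ 2.

(*  p := (L+1) n ; state index i < p, block number i / n.                  *)

(* Atilde: A in block (1,1), I_n in blocks (k+1,k), k = 1..L *)
Definition At {R : realType} n L (A : 'M[R]_n) : 'M[R]_(L.+1 * n) :=
  \matrix_(i, j) (if ((i : nat) < n)%N && ((j : nat) < n)%N then ent A i j
                  else if (i : nat) == (j + n)%N then 1 else 0).

(* Btilde = [B; 0; ...; 0] *)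
Definition Bt {R : realType} n m L (B : 'M[R]_(n, n + m)) : 'M[R]_(L.+1 * n, n + m) :=
  \matrix_(i, j) ent B i j.

(* Ctilde = [C 0 ... 0] *)
Definition Ct {R : realType} n m L (C : 'M[R]_(m, n)) : 'M[R]_(m, L.+1 * n) :=
  \matrix_(i, j) ent C i j.

(* Htilde = [0 ... 0 I_n] *)
Definition Ht {R : realType} n L : 'M[R]_(n, L.+1 * n) :=
  \matrix_(i, j) (if (j : nat) == (i + L * n)%N then 1 else 0).

(* Integration over R^N (Lebesgue measure), as iterated integrals.        *)
(* For nonnegative measurable integrands this is the Lebesgue integral     *)
(* on R^N (Tonelli).                                                      *)

Fixpoint iint {R : realType} (N : nat) : (N.-tuple R -> \bar R) -> \bar R :=
  match N return (N.-tuple R -> \bar R) -> \bar R with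
  | 0 => fun f => f [tuple]
  | N'.+1 => fun f =>
      (\int[@lebesgue_measure R]_x iint (fun v : N'.-tuple R => f [tuple of x :: v]))%E
  end.

Definition tup2col {R : realType} N (t : N.-tuple R) : 'cV[R]_N :=
  \col_i tnth t i.

Definition intV {R : realType} N (f : 'cV[R]_N -> \bar R) : \bar R :=
  iint (fun t => f (tup2col t)).

Definition intVs {R : realType} N (f : 'cV[R]_N -> R) : \bar R :=
  (intV (fun z => (Num.max (f z) 0)%:E) - intV (fun z => (Num.max (- f z) 0)%:E))%E.

Definition measV {R : realType} N (f : 'cV[R]_N -> R) : Prop :=
  measurable_fun setT (fun t : N.-tuple R => f (tup2col t)).

Definition is_density {R : realType} N (f : 'cV[R]_N -> R) : Prop :=
  [/\ measV f, forall z, 0 <= f z & intV (fun z => (f z)%:E) = 1%E].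

Definition gauss_pdf {R : realType} N (mu : 'cV[R]_N) (K : 'M[R]_N) (z : 'cV[R]_N) : R :=
  (Num.sqrt (2 * pi)) ^- N / Num.sqrt (\det K) *
  expR (- (1 / 2) * ((z - mu)^T *m invmx K *m (z - mu)) 0 0).

Definition KL {R : realType} N (f g : 'cV[R]_N -> R) : \bar R :=
  intVs (fun z => f z * ln (f z / g z)).

Definition marg {R : realType} p m (f : 'cV[R]_(p + m) -> R) (y : 'cV[R]_m) : \bar R :=
  intV (fun x : 'cV[R]_p => (f (col_mx x y))%:E).

Definition cond_density {R : realType} p m (f : 'cV[R]_(p + m) -> R)
    (y : 'cV[R]_m) (x : 'cV[R]_p) : R :=
  f (col_mx x y) / fine (marg f y).

Definition ambiguity {R : realType} N (fbar : 'cV[R]_N -> R) (c : R)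
    (f : 'cV[R]_N -> R) : Prop :=
  is_density f /\ (KL f fbar <= c%:E)%E.

Definition Jcost {R : realType} n p m (H : 'M[R]_(n, p))
    (f : 'cV[R]_(p + m) -> R) (g : 'cV[R]_m -> 'cV[R]_p) : \bar R :=
  intV (fun z => ((1 / 2) * sqnorm (H *m (usubmx z - g (dsubmx z))) * f z)%:E).

Definition estimators {R : realType} p m (fbar : 'cV[R]_(p + m) -> R) (c : R)
    (g : 'cV[R]_m -> 'cV[R]_p) : Prop :=
  (forall i, measV (fun y => g y i 0)) /\
  forall f, ambiguity fbar c f ->
    (intV (fun z => (sqnorm (g (dsubmx z)) * f z)%:E) < +oo)%E.

(* Main.v *)
(* The tilted density [f0] is [fbar exp (q / lt) / Z] with
   [q z = |H (xi - g0 y)|^2 / 2], because both covariances share the factors [G]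
   and [S] of their block decomposition.  For every density [f] the pointwise
   form of Gibbs' inequality bounds [E_f q] by [lt (KL f fbar + ln Z)], with
   equality at [f0], whose divergence is [gamma lt = c]: this is the left saddle
   inequality.  The right one is Tonelli plus the fact that, conditionally on [y],
   the mean [g0 y] minimises the expected quadratic loss.  For (i), Sylvester's
   identity and the real spectral theorem turn [gamma l] into
   [1/2 \sum_i psi (1 - mu_i / l)] with [psi u = 1/u - 1 + ln u], where the [mu_i]
   are the eigenvalues of [H P H^T]. *)
Require Import Defs.
From HB Require Import structures.
From mathcomp Require Import all_boot all_order all_algebra.
From mathcomp Require Import all_classical all_reals all_analysis.
From mathcomp Require Import measurable_realfun normal_distribution.
From mathcomp Require complex spectral sesquilinear.
From mathcomp Require Import ring lra.
Set Implicit Arguments. Unset Strict Implicit. Unset Printing Implicit Defensive.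
Import Order.TTheory GRing.Theory Num.Theory.
Local Open Scope classical_set_scope.
Local Open Scope ring_scope.

(** * Iterated integrals *)

(** [KL] is a difference of two extended-real integrals, so linearity is available only for
    nonnegative integrands. This shapes the argument: Gibbs' inequality is rearranged until every
    term on both sides is nonnegative, with the positive and negative parts of [f ln (f / p)] on
    opposite sides, and is then integrated term by term. Its case [q = k = 0] bounds the integral of
    the negative part by 1, so a bound on [KL] also makes the positive part finite.

    Gaussian integrals are computed without a change of variables in several dimensions. A block
    factorisation of the covariance splits off one coordinate, and integrands of the form
    [k + (affine form)^2] keep that form when this coordinate is integrated out.

    The equation [gamma lt = c] enters as [tr (H V1 H^T) / 2 = lt (c + ln Z)], which says that the
    tilted law attains the bound of Gibbs' inequality.

    Positivity of [P] is not immediate, because the lifted noise covariance has rank at most [n];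
    the shift blocks of the lifted dynamics compensate for this. *)

Section iterated_integral.
Context {R : realType}.
Local Notation leb := (@lebesgue_measure R).
Local Open Scope ereal_scope.

Lemma iint_ge0 N (f : N.-tuple R -> \bar R) : (forall v, 0 <= f v) -> 0 <= iint f.
Proof.
elim: N f => [|N IH] f f0 /=; first exact: f0.
by apply: integral_ge0 => x _; apply: IH.
Qed.

Lemma eq_iint N (f g : N.-tuple R -> \bar R) : f =1 g -> iint f = iint g.
Proof. by move=> /funext ->. Qed.

(** The parameter space [T] is arbitrary because the induction moves the first tuple coordinate into
    it, replacing [T] by [T * R]; one Tonelli step then integrates this coordinate out. *)
Lemma measurable_iint N d (T : measurableType d) (f : T * N.-tuple R -> \bar R) :
  measurable_fun [set: T * N.-tuple R] f -> (forall p, 0 <= f p) ->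
  measurable_fun setT (fun t => iint (fun v => f (t, v))).
Proof.
elim: N d T f => [|N IH] d T f mf f0 /=.
  apply: (measurableT_comp mf).
  apply: measurable_fun_pair; [exact: measurable_id|exact: measurable_cst].
pose g (p : (T * R) * N.-tuple R) := f (p.1.1, [tuple of p.1.2 :: p.2]).
have mg : measurable_fun [set: _ * N.-tuple R] g.
  apply: (measurableT_comp mf); apply: measurable_fun_pair => /=.
    exact: (measurableT_comp measurable_fst measurable_fst).
  apply: measurable_cons; last exact: measurable_snd.
  exact: (measurableT_comp measurable_snd measurable_fst).
have mh := IH _ _ g mg (fun p => f0 _).
have mh' : measurable_fun [set: T * measurableTypeR R]
  (fun t : T * measurableTypeR R => iint (fun v => g (t, v))) by exact: mh.
apply: (@measurable_fun_fubini_tonelli_F _ _ _ _ _ leb _ mh') => p.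
by apply: iint_ge0 => v; exact: f0.
Qed.

Lemma measurable_iint_cons N (f : N.+1.-tuple R -> \bar R) :
  measurable_fun [set: N.+1.-tuple R] f -> (forall v, 0 <= f v) ->
  measurable_fun setT (fun x : R => iint (fun v : N.-tuple R => f [tuple of x :: v])).
Proof.
move=> mf f0.
apply: (@measurable_iint _ _ _ (fun p => f [tuple of p.1 :: p.2])) => [|p]; last exact: f0.
by apply: (measurableT_comp mf); apply: measurable_cons.
Qed.

Lemma measurable_consr N (f : N.+1.-tuple R -> \bar R) x :
  measurable_fun [set: N.+1.-tuple R] f ->
  measurable_fun setT (fun v : N.-tuple R => f [tuple of x :: v]).
Proof.
by move=> mf; apply: (measurableT_comp mf); apply: measurable_cons => //; exact: measurable_id.
Qed.

Lemma le_iint N (f g : N.-tuple R -> \bar R) :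
  measurable_fun [set: N.-tuple R] f -> measurable_fun [set: N.-tuple R] g ->
  (forall v, 0 <= f v) ->
  (forall v, f v <= g v) -> iint f <= iint g.
Proof.
elim: N f g => [|N IH] f g mf mg f0 fg /=; first exact: fg.
have g0 v : 0 <= g v by apply: le_trans (fg v).
apply: ge0_le_integral => //.
- by move=> x _; exact: iint_ge0.
- exact: measurable_iint_cons.
- exact: measurable_iint_cons.
- move=> x _; apply: IH => [||v|v].
  + exact (measurable_consr x mf).
  + exact (measurable_consr x mg).
  + exact: f0.
  + exact: fg.
Qed.

Lemma iintD N (f g : N.-tuple R -> \bar R) :
  measurable_fun [set: N.-tuple R] f -> measurable_fun [set: N.-tuple R] g ->
  (forall v, 0 <= f v) ->
  (forall v, 0 <= g v) -> iint (fun v => f v + g v) = iint f + iint g.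
Proof.
elim: N f g => [//|N IH] f g mf mg f0 g0 /=.
rewrite -ge0_integralD//.
- apply: eq_integral => x _; apply: IH => [||v|v].
  + exact (measurable_consr x mf).
  + exact (measurable_consr x mg).
  + exact: f0.
  + exact: g0.
- by move=> x _; exact: iint_ge0.
- exact: measurable_iint_cons.
- by move=> x _; exact: iint_ge0.
- exact: measurable_iint_cons.
Qed.

Lemma iintZ N (f : N.-tuple R -> \bar R) (k : R) :
  measurable_fun [set: N.-tuple R] f -> (forall v, 0 <= f v) -> (0 <= k)%R ->
  iint (fun v => k%:E * f v) = k%:E * iint f.
Proof.
elim: N f => [//|N IH] f mf f0 k0 /=.
rewrite -ge0_integralZl_EFin//.
- apply: eq_integral => x _; apply: IH => //; exact (measurable_consr x mf).
- by move=> x _; exact: iint_ge0.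
- exact: measurable_iint_cons.
Qed.

Lemma integral_iint_swap N (f : R * N.-tuple R -> \bar R) :
  measurable_fun [set: R * N.-tuple R] f -> (forall p, 0 <= f p) ->
  \int[leb]_x iint (fun v => f (x, v)) = iint (fun v => \int[leb]_x f (x, v)).
Proof.
elim: N f => [//|N IH] f mf f0 /=.
pose g (p : (R * R) * N.-tuple R) := f (p.1.1, [tuple of p.1.2 :: p.2]).
have mg : measurable_fun [set: _ * N.-tuple R] g.
  apply: (measurableT_comp mf); apply: measurable_fun_pair => /=.
    exact: (measurableT_comp measurable_fst measurable_fst).
  apply: measurable_cons; last exact: measurable_snd.
  exact: (measurableT_comp measurable_snd measurable_fst).
have mg' : measurable_fun [set: measurableTypeR R * measurableTypeR R]
  (fun p : measurableTypeR R * measurableTypeR R => iint (fun v => g (p, v))).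
  exact: (measurable_iint mg (fun p => f0 _)).
have := @fubini_tonelli _ _ _ _ _ leb leb _ mg' (fun p => iint_ge0 (fun v => f0 _)).
rewrite /g /= => ->.
apply: eq_integral => x' _; rewrite /g /=.
apply: (IH (fun p => f (p.1, [tuple of x' :: p.2]))) => [|p]; last exact: f0.
apply: (measurableT_comp mf); apply: measurable_fun_pair => //=.
by apply: measurable_cons => //; exact: measurable_snd.
Qed.

(** Tonelli for blocks of coordinates: induction on [p] sets the first coordinate of [x] aside, and
    [integral_iint_swap] carries that single coordinate past the whole of [y]. *)
Lemma iint_swap p m (f : p.-tuple R * m.-tuple R -> \bar R) :
  measurable_fun [set: p.-tuple R * m.-tuple R] f -> (forall q, 0 <= f q) ->
  iint (fun x => iint (fun y => f (x, y))) = iint (fun y => iint (fun x => f (x, y))).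
Proof.
elim: p f => [//|p IH] f mf f0 /=.
transitivity (\int[leb]_x iint (fun y : m.-tuple R =>
    iint (fun v : p.-tuple R => f ([tuple of x :: v], y)))).
  apply: eq_integral => x _.
  apply: (IH (fun q => f ([tuple of x :: q.1], q.2))) => [|q]; last exact: f0.
  apply: (measurableT_comp mf); apply: measurable_fun_pair => //=.
  by apply: measurable_cons => //; exact: measurable_fst.
pose g (q : (R * m.-tuple R) * p.-tuple R) := f ([tuple of q.1.1 :: q.2], q.1.2).
apply: (@integral_iint_swap _ (fun q => iint (fun v => g (q, v)))) => [|q].
  2: by apply: iint_ge0 => v; exact: f0.
apply: (measurable_iint (f := g)) => [|q]; last exact: f0.
apply: (measurableT_comp mf); apply: measurable_fun_pair => /=.
  apply: measurable_cons; last exact: measurable_snd.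
  exact: (measurableT_comp measurable_fst measurable_fst).
exact: (measurableT_comp measurable_snd measurable_fst).
Qed.

Lemma tup2col_cons N x (v : N.-tuple R) :
  tup2col [tuple of x :: v] = col_mx (x%:M : 'cV_1) (tup2col v) :> 'cV_(1 + N)%N.
Proof.
apply/matrixP => i j; rewrite ord1 mxE (tnth_nth 0%R) /=.
case: (split_ordP i) => k ->.
  by rewrite col_mxEu mxE (ord1 k).
by rewrite col_mxEd mxE (tnth_nth 0%R).
Qed.

(** True for arbitrary [f], measurable or not, since [iint] is nested by construction; the work lies
    in matching tuple coordinates with the blocks of [col_mx]. *)
Lemma iint_cat p m (f : 'cV[R]_(p + m) -> \bar R) :
  iint (fun t => f (tup2col t)) =
  iint (fun x : p.-tuple R => iint (fun y : m.-tuple R =>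
    f (col_mx (tup2col x) (tup2col y)))).
Proof.
elim: p f => [|p IH] f /=.
  apply: eq_iint => t; congr f; apply/matrixP => i j.
  case: (split_ordP i) => [[]//|k ->]; rewrite col_mxEd !mxE.
  by congr tnth; apply/val_inj.
apply: eq_integral => x _.
have := IH (fun z => f (col_mx (x%:M : 'cV_1) z)).
rewrite (_ : iint _ = iint (fun v : (p + m).-tuple R => f (tup2col [tuple of x :: v]))); last first.
  by apply: eq_iint => v; rewrite tup2col_cons.
move=> ->; apply: eq_iint => y; apply: eq_iint => z; congr f.
have hc : (tup2col [tuple of x :: y] : 'cV_(1 + p)%N) = col_mx (x%:M : 'cV_1) (tup2col y).
  exact: tup2col_cons.
(* The cast in [col_mxA] relates two convertible dimensions, so [castmx_id] removes it. *)
have hA := @col_mxA R 1 p m 1 (x%:M) (tup2col y) (tup2col z).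
rewrite -hc in hA; apply: etrans hA _.
exact: (@castmx_id R (1 + p + m)%N 1).
Qed.

End iterated_integral.

(** * Measurability of functions and maps of column vectors, coordinate by coordinate *)

Section vector_measurability.
Context {R : realType}.

Definition mfunV N (f : 'cV[R]_N -> \bar R) :=
  measurable_fun [set: N.-tuple R] (fun t : N.-tuple R => f (tup2col t)).

Definition mmap d (T : measurableType d) N (F : T -> 'cV[R]_N) :=
  forall i, measurable_fun setT (fun t => F t i 0).

Lemma mfunV_EFin N (f : 'cV[R]_N -> R) : measV f -> mfunV (fun z => (f z)%:E).
Proof. by move=> mf; apply/measurable_EFinP. Qed.

Lemma tup2colK N (x : 'cV[R]_N) : tup2col [tuple x i 0 | i < N] = x.
Proof. by apply/matrixP => i j; rewrite mxE ord1 tnth_mktuple. Qed.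

Lemma mmap_tuple d (T : measurableType d) N (F : T -> 'cV[R]_N) : mmap F ->
  measurable_fun setT (fun t => [tuple F t i 0 | i < N]).
Proof.
move=> mF; apply/measurable_fun_tnthP => i.
rewrite (_ : _ \o _ = fun t => F t i 0); first exact: mF.
by apply/funext => t /=; rewrite tnth_mktuple.
Qed.

Lemma mfunV_comp d (T : measurableType d) N (F : T -> 'cV[R]_N) (f : 'cV[R]_N -> \bar R) :
  mfunV f -> mmap F -> measurable_fun setT (fun t => f (F t)).
Proof.
move=> mf /mmap_tuple mF.
rewrite (_ : (fun _ => _) = (fun t : N.-tuple R => f (tup2col t)) \o
  (fun t => [tuple F t i 0 | i < N])); last by apply/funext => t /=; rewrite tup2colK.
exact: measurableT_comp.
Qed.

Lemma measV_comp d (T : measurableType d) N (F : T -> 'cV[R]_N) (f : 'cV[R]_N -> R) :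
  measV f -> mmap F -> measurable_fun setT (fun t => f (F t)).
Proof. by move=> /mfunV_EFin mf mF; apply/measurable_EFinP; exact: (mfunV_comp mf mF). Qed.

Lemma mmap_tup2col N : mmap (@tup2col R N).
Proof.
move=> i; rewrite (_ : (fun _ => _) = (fun t => tnth t i)); first exact: measurable_tnth.
by apply/funext => t; rewrite mxE.
Qed.

Section closure.
Context d (T : measurableType d).

Lemma mmap_cst N (a : 'cV[R]_N) : mmap (fun _ : T => a).
Proof. by move=> i; exact: measurable_cst. Qed.

Lemma mmapD N (F G : T -> 'cV[R]_N) : mmap F -> mmap G -> mmap (fun t => F t + G t).
Proof.
move=> mF mG i; rewrite (_ : (fun _ => _) = (fun t => F t i 0 + G t i 0)).
  exact: measurable_funD.
by apply/funext => t; rewrite mxE.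
Qed.

Lemma mmapB N (F G : T -> 'cV[R]_N) : mmap F -> mmap G -> mmap (fun t => F t - G t).
Proof.
move=> mF mG i; rewrite (_ : (fun _ => _) = (fun t => F t i 0 - G t i 0)).
  exact: measurable_funB.
by apply/funext => t; rewrite !mxE.
Qed.

Lemma mmap_mulmx M N (A : 'M[R]_(M, N)) (F : T -> 'cV[R]_N) :
  mmap F -> mmap (fun t => A *m F t).
Proof.
move=> mF i; rewrite (_ : (fun _ => _) = (fun t => \sum_j A i j * F t j 0)).
  by apply: measurable_sum => j; apply: measurable_funM => //; exact: measurable_cst.
by apply/funext => t; rewrite mxE.
Qed.

Lemma mmap_dot N (F G : T -> 'cV[R]_N) : mmap F -> mmap G ->
  measurable_fun setT (fun t => ((F t)^T *m G t) 0 0).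
Proof.
move=> mF mG; rewrite (_ : (fun _ => _) = (fun t => \sum_j F t j 0 * G t j 0)).
  by apply: measurable_sum => j; exact: measurable_funM.
by apply/funext => t; rewrite mxE; apply: eq_bigr => j _; rewrite mxE.
Qed.

Lemma mmap_col_mx p N (F : T -> 'cV[R]_p) (G : T -> 'cV[R]_N) :
  mmap F -> mmap G -> mmap (fun t => col_mx (F t) (G t)).
Proof.
move=> mF mG i; case: (split_ordP i) => k ->.
  by rewrite (_ : (fun _ => _) = (fun t => F t k 0)) //; apply/funext => t; rewrite col_mxEu.
by rewrite (_ : (fun _ => _) = (fun t => G t k 0)) //; apply/funext => t; rewrite col_mxEd.
Qed.

Lemma mmap_usubmx p N (F : T -> 'cV[R]_(p + N)) : mmap F -> mmap (fun t => usubmx (F t)).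
Proof.
move=> mF i; rewrite (_ : (fun _ => _) = (fun t => F t (lshift N i) 0)) //.
by apply/funext => t; rewrite mxE.
Qed.

Lemma mmap_dsubmx p N (F : T -> 'cV[R]_(p + N)) : mmap F -> mmap (fun t => dsubmx (F t)).
Proof.
move=> mF i; rewrite (_ : (fun _ => _) = (fun t => F t (rshift p i) 0)) //.
by apply/funext => t; rewrite mxE.
Qed.

End closure.

Lemma sqnormE N (x : 'cV[R]_N) : sqnorm x = (x^T *m x) 0 0.
Proof. by rewrite mxE; apply: eq_bigr => i _; rewrite mxE expr2. Qed.

Lemma sqnorm_ge0 N (x : 'cV[R]_N) : 0 <= sqnorm x.
Proof. by apply: sumr_ge0 => i _; exact: sqr_ge0. Qed.

Lemma measV_gauss N (mu : 'cV[R]_N) K : measV (gauss_pdf mu K).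
Proof.
rewrite /measV /gauss_pdf; apply: measurable_funM; first exact: measurable_cst.
apply: measurableT_comp; first exact: measurable_expR.
apply: measurable_funM; first exact: measurable_cst.
under eq_fun do rewrite -mulmxA.
have mF : mmap (fun t : N.-tuple R => tup2col t - mu).
  by apply: mmapB; [exact: mmap_tup2col|exact: mmap_cst].
by apply: mmap_dot => //; exact: mmap_mulmx.
Qed.

End vector_measurability.

Section vector_integral.
Context {R : realType}.
Local Open Scope ereal_scope.

Lemma intV_ge0 N (f : 'cV[R]_N -> \bar R) : (forall v, 0 <= f v) -> 0 <= intV f.
Proof. by move=> f0; apply: iint_ge0. Qed.

Lemma eq_intV N (f g : 'cV[R]_N -> \bar R) : f =1 g -> intV f = intV g.
Proof. by move=> /funext ->. Qed.

Lemma le_intV N (f g : 'cV[R]_N -> \bar R) : mfunV f -> mfunV g ->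
  (forall v, 0 <= f v) -> (forall v, f v <= g v) -> intV f <= intV g.
Proof. by move=> mf mg f0 fg; apply: le_iint. Qed.

Lemma intVD N (f g : 'cV[R]_N -> \bar R) : mfunV f -> mfunV g ->
  (forall v, 0 <= f v) -> (forall v, 0 <= g v) ->
  intV (fun v => f v + g v) = intV f + intV g.
Proof. by move=> mf mg f0 g0; apply: iintD. Qed.

Lemma intVZ N (f : 'cV[R]_N -> \bar R) (k : R) : mfunV f ->
  (forall v, 0 <= f v) -> (0 <= k)%R -> intV (fun v => k%:E * f v) = k%:E * intV f.
Proof. by move=> mf f0 k0; apply: iintZ. Qed.

(** The block [y] goes outside so that, for a Gaussian, the inner integral is taken against the
    conditional law of [x] given [y]. *)
Lemma intV_swap p m (f : 'cV[R]_(p + m) -> \bar R) : mfunV f -> (forall v, 0 <= f v) ->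
  intV f = intV (fun y : 'cV_m => intV (fun x : 'cV_p => f (col_mx x y))).
Proof.
move=> mf f0; rewrite /intV iint_cat.
apply: (@iint_swap _ _ _ (fun q => f (col_mx (tup2col q.1) (tup2col q.2)))) => [|q//].
apply: (mfunV_comp mf); apply: mmap_col_mx => i.
  exact: (measurableT_comp (mmap_tup2col i) measurable_fst).
exact: (measurableT_comp (mmap_tup2col i) measurable_snd).
Qed.

Lemma intV1 (f : 'cV[R]_1 -> \bar R) : intV f = \int[lebesgue_measure]_x f (x%:M).
Proof.
rewrite /intV /=; apply: eq_integral => x _; congr f.
by apply/matrixP => i j; rewrite !ord1 !mxE (tnth_nth 0%R).
Qed.

End vector_integral.

(** * Positive definite matrices *)

Section positive_definite.
Context {R : realType}.

Definition quad N (M : 'M[R]_N) (x : 'cV[R]_N) : R := (x^T *m M *m x) 0 0.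

Lemma quad0 N (M : 'M[R]_N) : quad M 0 = 0.
Proof. by rewrite /quad mulmx0 mxE. Qed.

Lemma quad_mul M N (A : 'M[R]_(M, N)) K x : quad (A^T *m K *m A) x = quad K (A *m x).
Proof. by rewrite /quad trmx_mul !mulmxA. Qed.

Lemma quadD N (M1 M2 : 'M[R]_N) x : quad (M1 + M2) x = quad M1 x + quad M2 x.
Proof. by rewrite /quad mulmxDr mulmxDl mxE. Qed.

Lemma quadZ N (M : 'M[R]_N) a x : quad (a *: M) x = a * quad M x.
Proof. by rewrite /quad -scalemxAr -scalemxAl mxE. Qed.

Lemma posdef_ge0 N (M : 'M[R]_N) x : posdef M -> 0 <= quad M x.
Proof.
move=> [_ hM]; have [->|/hM/ltW//] := eqVneq x 0.
by rewrite quad0.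
Qed.

Lemma posdef_eq0 N (M : 'M[R]_N) x : posdef M -> quad M x = 0 -> x = 0.
Proof.
move=> [_ hM] q0; apply/eqP/negPn/negP => /hM.
by rewrite -/(quad M x) q0 ltxx.
Qed.

Lemma posdef_congr M N (A : 'M[R]_(M, N)) K : posdef K ->
  (forall x : 'cV_N, A *m x = 0 -> x = 0) -> posdef (A^T *m K *m A).
Proof.
move=> [sK hK] inj; split; first by rewrite !trmx_mul trmxK sK mulmxA.
move=> x x0; rewrite -/(quad _ x) quad_mul; apply: hK.
by apply: contra_neq x0; exact: inj.
Qed.

Lemma unit_mulmx_eq0 N (A : 'M[R]_N) (x : 'cV[R]_N) : A \in unitmx -> A *m x = 0 -> x = 0.
Proof. by move=> uA /(congr1 (mulmx (invmx A))); rewrite mulKmx// mulmx0. Qed.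

(** The covariance of a pair [(x, y)]: [S] is the covariance of [y], [G] the regression gain of [x]
    on [y], and [W] the conditional covariance of [x] given [y], that is, the Schur complement of
    [S]. *)
Definition uschur p m (G : 'M[R]_(p, m)) (W : 'M[R]_p) (S : 'M[R]_m) : 'M[R]_(p + m) :=
  block_mx 1%:M G 0 1%:M *m block_mx W 0 0 S *m block_mx 1%:M 0 G^T 1%:M.

Lemma uschurE p m (G : 'M[R]_(p, m)) (W : 'M[R]_p) (S : 'M[R]_m) :
  uschur G W S = block_mx (W + G *m S *m G^T) (G *m S) (S *m G^T) S.
Proof.
by rewrite /uschur !mulmx_block !(mul1mx, mulmx1, mul0mx, mulmx0, addr0, add0r).
Qed.

Lemma quad_uschur p m (G : 'M[R]_(p, m)) (W : 'M[R]_p) (S : 'M[R]_m) x y :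
  quad (uschur G W S) (col_mx x y) = quad W x + quad S (G^T *m x + y).
Proof.
have -> : uschur G W S =
    (block_mx 1%:M 0 G^T 1%:M)^T *m block_mx W 0 0 S *m block_mx 1%:M 0 G^T 1%:M.
  by rewrite tr_block_mx !trmx1 trmx0 trmxK.
rewrite quad_mul mul_block_col !mul1mx mul0mx addr0 /quad tr_col_mx mul_row_block.
by rewrite !mulmx0 addr0 add0r mul_row_col mxE.
Qed.

Lemma posdef_uschur p m (G : 'M[R]_(p, m)) (W : 'M[R]_p) (S : 'M[R]_m) :
  posdef W -> posdef S -> posdef (uschur G W S).
Proof.
move=> pW pS; split.
  rewrite uschurE tr_block_mx raddfD /= !trmx_mul trmxK.
  by case: pW => -> _; case: pS => -> _; rewrite mulmxA.
move=> z z0; rewrite -/(quad _ z) -(vsubmxK z) quad_uschur.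
have := posdef_ge0 (usubmx z) pW; rewrite le_eqVlt => /predU1P[q0|qpos]; last first.
  by apply: ltr_wpDr => //; exact: posdef_ge0.
have x0 := posdef_eq0 pW (esym q0).
rewrite x0 mulmx0 add0r quad0 add0r; case: pS => _; apply.
apply: contra_neq z0 => y0.
by rewrite -(vsubmxK z) x0 y0 col_mx0.
Qed.

Lemma posdef_uschur_inv p m (G : 'M[R]_(p, m)) (W : 'M[R]_p) (S : 'M[R]_m) :
  posdef (uschur G W S) -> posdef W /\ posdef S.
Proof.
move=> [sK pK].
have pS : posdef S.
  split.
    by move: sK; rewrite uschurE tr_block_mx => /eq_block_mx[].
  move=> y y0; have := pK (col_mx 0 y); rewrite -/(quad _ _) quad_uschur.
  rewrite mulmx0 add0r quad0 add0r; apply; apply: contra_neq y0.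
  by rewrite -col_mx0 => /eq_col_mx[].
split=> //; split.
  move: sK; rewrite uschurE tr_block_mx => /eq_block_mx[+ _ _ _].
  rewrite raddfD /= !trmx_mul trmxK; case: pS => -> _.
  by rewrite mulmxA => /addIr.
(* The second block [- G^T x] cancels the [S] term of [quad_uschur] and leaves [quad W x]. *)
move=> x x0; have := pK (col_mx x (- (G^T *m x))); rewrite -/(quad _ _) quad_uschur.
rewrite subrr quad0 addr0; apply; apply: contra_neq x0.
by rewrite -col_mx0 => /eq_col_mx[].
Qed.

Lemma det_uschur p m (G : 'M[R]_(p, m)) (W : 'M[R]_p) (S : 'M[R]_m) :
  \det (uschur G W S) = \det W * \det S.
Proof.
by rewrite /uschur !det_mulmx !(det_ublock, det_lblock) !det1 !mul1r mulr1.
Qed.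

Lemma uschur_decomp p m (K : 'M[R]_(p + m)) : K^T = K -> drsubmx K \in unitmx ->
  let S := drsubmx K in let G := ursubmx K *m invmx S in
  K = uschur G (ulsubmx K - G *m S *m G^T) S.
Proof.
move=> sK uS S G.
have sS : S^T = S by rewrite /S -{2}sK trmx_drsub.
rewrite uschurE subrK /G mulmxKV// trmx_mul trmx_inv sS mulKVmx//.
by rewrite trmx_ursub sK -/S submxK.
Qed.

Lemma posdef_drsubmx p m (K : 'M[R]_(p + m)) : posdef K -> posdef (drsubmx K).
Proof.
move=> [sK pK]; split; first by rewrite trmx_drsub sK.
move=> y y0; have := pK (col_mx 0 y).
rewrite -{1}(submxK K) tr_col_mx mul_row_block mul_row_col trmx0 !mul0mx !add0r mulmx0 add0r.
apply; apply: contra_neq y0.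
by rewrite -col_mx0 => /eq_col_mx[].
Qed.

Lemma posdef1_gt0 (W : 'M[R]_1) : posdef W -> 0 < W 0 0.
Proof.
case=> _ /(_ 1%:M); rewrite trmx1 mul1mx mulmx1; apply.
by apply/eqP => /matrixP /(_ 0 0); rewrite !mxE /= => /eqP; rewrite oner_eq0.
Qed.

(** Splitting off one coordinate at a time writes the determinant as a product of 1 x 1 Schur
    complements, each of them positive. *)
Lemma posdef_det_gt0 N (K : 'M[R]_N) : posdef K -> 0 < \det K.
Proof.
elim: N K => [|N IH] K; first by rewrite det_mx00 ltr01.
rewrite -[N.+1]/(1 + N)%N in K *.
move=> pK; have dS := IH _ (posdef_drsubmx pK).
have uS : drsubmx K \in unitmx by rewrite unitmxE unitfE gt_eqF.
have EK := uschur_decomp (proj1 pK) uS.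
move: pK; rewrite EK => /posdef_uschur_inv[pW _].
rewrite det_uschur; apply: mulr_gt0 => //.
by rewrite [X in \det X]mx11_scalar det_scalar1; exact: posdef1_gt0.
Qed.

Lemma posdef_unit N (K : 'M[R]_N) : posdef K -> K \in unitmx.
Proof. by move=> /posdef_det_gt0 K0; rewrite unitmxE unitfE gt_eqF. Qed.

Lemma posdef_uschur_decomp p m (K : 'M[R]_(p + m)) : posdef K ->
  exists G W S, [/\ K = uschur G W S, posdef W & posdef S].
Proof.
move=> pK; have pS := posdef_drsubmx pK.
have EK := uschur_decomp (proj1 pK) (posdef_unit pS).
move: pK; rewrite EK => /posdef_uschur_inv[pW pS'].
by do 3 eexists; split; [by []|exact: pW|exact: pS'].
Qed.

Lemma posdef_inv N (K : 'M[R]_N) : posdef K -> posdef (invmx K).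
Proof.
move=> pK; have uK := posdef_unit pK; case: (pK) => sK hK.
have -> : invmx K = (invmx K)^T *m K *m invmx K by rewrite mulmxK// trmx_inv sK.
by apply: posdef_congr => // x; apply: unit_mulmx_eq0; rewrite unitmx_inv.
Qed.

Lemma invmx_uschur p m (G : 'M[R]_(p, m)) (W : 'M[R]_p) (S : 'M[R]_m) :
  W \in unitmx -> S \in unitmx ->
  invmx (uschur G W S) = (block_mx 1%:M (- G) 0 1%:M)^T *m
    block_mx (invmx W) 0 0 (invmx S) *m block_mx 1%:M (- G) 0 1%:M.
Proof.
move=> uW uS; set J := (RHS).
have KJ : J *m uschur G W S = 1%:M.
  rewrite /J /uschur tr_block_mx !trmx1 trmx0 !mulmxA.
  rewrite -(mulmxA _ (block_mx 1%:M (- G) 0 1%:M)) !mulmx_block.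
  rewrite !(mul1mx, mulmx1, mul0mx, mulmx0, addr0, add0r, subrr, addNr) !mulVmx//.
  rewrite linearN /= !mulNmx -!mulmxA !mulVmx// !mulmx1 ?mul1mx ?addNr ?subrr.
  by rewrite -scalar_mx_block.
have uK : uschur G W S \in unitmx by rewrite unitmxE det_uschur unitrM -!unitmxE uW uS.
by rewrite -[LHS]mul1mx -KJ mulmxK.
Qed.

Lemma quad_inv_uschur p m (G : 'M[R]_(p, m)) (W : 'M[R]_p) (S : 'M[R]_m) x y :
  W \in unitmx -> S \in unitmx ->
  quad (invmx (uschur G W S)) (col_mx x y) =
  quad (invmx W) (x - G *m y) + quad (invmx S) y.
Proof.
move=> uW uS; rewrite invmx_uschur// quad_mul mul_block_col !mul1mx mul0mx add0r mulNmx.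
rewrite /quad tr_col_mx mul_row_block !mulmx0 addr0 add0r mul_row_col mxE.
by [].
Qed.

(** Joint density as conditional times marginal: the exponent splits by [quad_inv_uschur], the
    normalising constant by [det_uschur]. The Gaussian integrals and conditional densities below
    rest on this. *)
Lemma gauss_pdf_uschur p m (G : 'M[R]_(p, m)) (W : 'M[R]_p) (S : 'M[R]_m) mx my x y :
  posdef W -> posdef S ->
  gauss_pdf (col_mx mx my) (uschur G W S) (col_mx x y) =
  gauss_pdf (mx + G *m (y - my)) W x * gauss_pdf my S y.
Proof.
move=> pW pS; rewrite /gauss_pdf; move: (Num.sqrt (2 * pi)) => e.
have uW := posdef_unit pW; have uS := posdef_unit pS.
rewrite opp_col_mx add_col_mx -/(quad _ _) quad_inv_uschur// det_uschur.
rewrite (@sqrtrM _ (\det W)) ?ltW ?posdef_det_gt0// -!/(quad _ _) opprD addrA exprD !invfM mulrDr.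
rewrite expRD.
ring.
Qed.

Lemma gauss_pdf_gt0 N (mu : 'cV[R]_N) K z : posdef K -> 0 < gauss_pdf mu K z.
Proof.
move=> pK; rewrite /gauss_pdf mulr_gt0 ?expR_gt0// divr_gt0 ?sqrtr_gt0 ?posdef_det_gt0//.
by rewrite invr_gt0 exprn_gt0// sqrtr_gt0 mulr_gt0// pi_gt0.
Qed.

End positive_definite.

(** * Gaussian moments *)

Section normal_moments.
Context {R : realType}.
Local Notation leb := (@lebesgue_measure R).

(** By uniqueness of Lebesgue measure, half-open intervals are enough; the reflection exchanges
    their open and closed ends and keeps their length. *)
Lemma lebesgue_measure_reflect (c : R) (A : set R) : measurable A ->
  pushforward leb ((fun x => c - x) : _ -> measurableTypeR R) A = leb A.
Proof.
have mphi : measurable_fun [set: R] (fun x : R => c - x).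
  by apply: measurable_funB => //; exact: measurable_cst.
move=> mA; apply/esym/lebesgue_measure_unique => //=.
move=> _ [[a b]] _ <-.
rewrite /pushforward (_ : _ @^-1` _ = `[c - b, c - a[%classic); last first.
  apply/seteqP; split => x /=; rewrite !in_itv /= => /andP[h1 h2]; apply/andP; split; lra.
rewrite !lebesgue_measure_itv /= !lte_fin ltrD2l ltrN2 -!EFinB.
by case: ifP => // _; congr EFin; ring.
Qed.

Lemma ge0_integral_reflect (c : R) (f : R -> \bar R) :
  measurable_fun [set: R] f -> (forall r, (0 <= f r)%E) ->
  (\int[leb]_x f x = \int[leb]_x f (c - x)%R)%E.
Proof.
move=> mf f0.
have mphi0 : measurable_fun [set: R] (fun x : R => c - x).
  by apply: measurable_funB => //; exact: measurable_cst.
have mphi : measurable_fun [set: measurableTypeR R]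
    ((fun x => c - x) : measurableTypeR R -> measurableTypeR R) by exact: mphi0.
have := @ge0_integral_pushforward _ _ _ _ _ _ mphi leb setT f measurableT mf (fun x _ => f0 x).
rewrite preimage_setT => <-.
by apply: eq_measure_integral => //= A mA AS; exact/esym/lebesgue_measure_reflect.
Qed.

Lemma normal_pdf_scale (m s r x : R) : 0 < s -> 0 < r ->
  r * normal_pdf m (r * s) x =
  normal_pdf m s x * expR ((1 - r ^- 2) / (2 * s ^+ 2) * (x - m) ^+ 2).
Proof.
move=> s0 r0; rewrite !normal_pdfE ?gt_eqF ?mulr_gt0//.
have -> : normal_peak (r * s) = r^-1 * normal_peak s.
  rewrite /normal_peak exprMn -mulrA -mulrnAr sqrtrM ?sqr_ge0// sqrtr_sqr gtr0_norm//.
  by rewrite invfM.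
have -> : normal_fun m (r * s) x =
    normal_fun m s x * expR ((1 - r ^- 2) / (2 * s ^+ 2) * (x - m) ^+ 2).
  rewrite /normal_fun -expRD; congr expR; field.
  by rewrite !gt_eqF.
by rewrite -!mulrA mulVKf ?gt_eqF.
Qed.

(* A squeeze replaces integration by parts: [e^z >= 1 + z] with
   [z = (1 - r^-2) (x - m)^2 / (2 s^2)] compares [N(m, s^2)] with [N(m, (r s)^2)],
   which bounds the moment from above for [r > 1], from below for [r < 1], and
   tightly as [r] tends to [1]. *)
Lemma ge0_integral_normal_sqr (m s : R) : 0 < s ->
  (\int[leb]_x (normal_pdf m s x * (x - m) ^+ 2)%:E = (s ^+ 2)%:E)%E.
Proof.
move=> s0; set I := (LHS).
pose q x : R := (x - m) ^+ 2.
have mq : measurable_fun [set: R] q.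
  by apply: measurable_funX; apply: measurable_funB => //; exact: measurable_cst.
have mp s' := @measurable_normal_pdf R m s'.
have I0 : (0 <= I)%E.
  by apply: integral_ge0 => x _; rewrite lee_fin mulr_ge0 ?normal_pdf_ge0 ?sqr_ge0.
have mpq : measurable_fun [set: R] (fun x => (normal_pdf m s x * q x)%:E).
  by apply/measurable_EFinP; exact: measurable_funM.
have mrp r : measurable_fun [set: R] (fun x : R => r * normal_pdf m (r * s) x).
  by apply: measurable_funM => //; exact: measurable_cst.
have hk r : 0 < r -> (\int[leb]_x (r * normal_pdf m (r * s) x)%:E = r%:E)%E.
  move=> r0; under eq_integral do rewrite EFinM.
  rewrite ge0_integralZl_EFin//; last 3 first.
  - by move=> x _; rewrite lee_fin normal_pdf_ge0.
  - by apply/measurable_EFinP; exact: mp.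
  - exact: ltW.
  by rewrite integral_normal_pdf mule1.
have up r : 1 < r -> (1 + ((1 - r ^- 2) / (2 * s ^+ 2))%:E * I <= r%:E)%E.
  move=> r1; have r0 : 0 < r by lra.
  set k := (X in (X%:E * I)%E).
  have k0 : 0 <= k.
    apply: divr_ge0; last by rewrite mulr_ge0 ?sqr_ge0.
    by rewrite subr_ge0 invf_le1 ?exprn_gt0// exprn_ege1// ltW.
  rewrite -(integral_normal_pdf m s) -(hk r r0) -ge0_integralZl_EFin//; last first.
    by move=> x _; rewrite lee_fin mulr_ge0 ?normal_pdf_ge0 ?sqr_ge0.
  rewrite -ge0_integralD//; last 4 first.
  - by move=> x _; rewrite lee_fin normal_pdf_ge0.
  - by apply/measurable_EFinP; exact: mp.
  - by move=> x _; rewrite -EFinM lee_fin mulr_ge0// mulr_ge0 ?normal_pdf_ge0 ?sqr_ge0.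
  - exact: measurable_funeM.
  apply: ge0_le_integral => //.
  - move=> x _; rewrite -EFinM -EFinD lee_fin addr_ge0 ?normal_pdf_ge0//.
    by rewrite mulr_ge0// mulr_ge0 ?normal_pdf_ge0 ?sqr_ge0.
  - apply: emeasurable_funD; first by apply/measurable_EFinP; exact: mp.
    exact: measurable_funeM.
  - by apply/measurable_EFinP; exact: mrp.
  - move=> x _; rewrite -EFinM -EFinD lee_fin normal_pdf_scale// -/k.
    rewrite -[X in X + _]mulr1 mulrCA -mulrDr ler_wpM2l ?normal_pdf_ge0//.
    exact: expR_ge1Dx.
(* For [r < 1] the coefficient of [I] is negative, so that term changes sides to keep both
   integrands nonnegative. *)
have dn r : 0 < r < 1 -> (1 <= r%:E + (- ((1 - r ^- 2) / (2 * s ^+ 2)))%:E * I)%E.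
  move=> /andP[r0 r1].
  set k := (X in ((- X)%:E * I)%E).
  have k0 : 0 <= - k.
    rewrite /k -mulNr; apply: divr_ge0; last by rewrite mulr_ge0 ?sqr_ge0.
    by rewrite opprB subr_ge0 invf_ge1 ?exprn_gt0// exprn_ile1// ltW.
  rewrite -(integral_normal_pdf m s) -(hk r r0) -ge0_integralZl_EFin//; last first.
    by move=> x _; rewrite lee_fin mulr_ge0 ?normal_pdf_ge0 ?sqr_ge0.
  rewrite -ge0_integralD//; last 4 first.
  - by move=> x _; rewrite lee_fin mulr_ge0 ?normal_pdf_ge0 ?ltW.
  - by apply/measurable_EFinP; exact: mrp.
  - by move=> x _; rewrite -EFinM lee_fin mulr_ge0// mulr_ge0 ?normal_pdf_ge0 ?sqr_ge0.
  - exact: measurable_funeM.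
  apply: ge0_le_integral => //.
  - by move=> x _; rewrite lee_fin normal_pdf_ge0.
  - by apply/measurable_EFinP; exact: mp.
  - apply: emeasurable_funD; last exact: measurable_funeM.
    by apply/measurable_EFinP; exact: mrp.
  - move=> x _; rewrite -EFinM -EFinD lee_fin normal_pdf_scale// -/k.
    have := expR_ge1Dx (k * q x); have := normal_pdf_ge0 m s x; rewrite -/(q x).
    move=> h1 h2; have := ler_wpM2l h1 h2; lra.
(* The bound [up] at [r = 2] suffices: the coefficient of [I] is positive there, so [I = +oo] would
   violate it. *)
have Ifin : I \is a fin_num.
  have : (1 < 2 :> R) by lra.
  move=> /up; case: (I) I0 => [//|_|//].
  rewrite gt0_muley ?addey ?leye_eq// lte_fin divr_gt0 ?mulr_gt0 ?exprn_gt0// subr_gt0.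
  by rewrite invf_lt1 ?exprn_gt0// exprn_egt1//; lra.
rewrite -(fineK Ifin); congr EFin; move: (fine I) (fineK Ifin) => i Ei.
rewrite -Ei in up dn.
(* Dividing by [r - 1] removes the degeneracy at [r = 1], because
   [(1 - r^-2) / (r - 1) = (r + 1) / r^2]; in the limit the inequality reads [2 i <= 2 s^2]. *)
have up' r : 1 < r -> i * (r + 1) <= 2 * r ^+ 2 * s ^+ 2.
  move=> r1; have := up r r1; rewrite -EFinM -EFinD lee_fin => h.
  have -> : i * (r + 1) = (2 * r ^+ 2 * s ^+ 2) / (r - 1) * ((1 - r ^- 2) / (2 * s ^+ 2) * i).
    by field; rewrite !gt_eqF//; lra.
  have -> : 2 * r ^+ 2 * s ^+ 2 = (2 * r ^+ 2 * s ^+ 2) / (r - 1) * (r - 1).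
    by field; rewrite gt_eqF//; lra.
  rewrite mulfVK ?gt_eqF ?subr_gt0//.
  rewrite -[leRHS](@mulfVK _ (r - 1)) ?gt_eqF ?subr_gt0//.
  apply: ler_wpM2l; last lra.
  by rewrite divr_ge0 ?mulr_ge0 ?sqr_ge0//; lra.
have dn' r : 0 < r < 1 -> 2 * r ^+ 2 * s ^+ 2 <= i * (r + 1).
  move=> r01; have := dn r r01; rewrite -EFinM -EFinD lee_fin => h.
  case/andP: r01 => r0 r1.
  have -> : i * (r + 1) = (2 * r ^+ 2 * s ^+ 2) / (1 - r) * (- ((1 - r ^- 2) / (2 * s ^+ 2)) * i).
    by field; rewrite !gt_eqF//; lra.
  rewrite -[leLHS](@mulfVK _ (1 - r)) ?gt_eqF ?subr_gt0//.
  apply: ler_wpM2l; last lra.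
  by rewrite divr_ge0 ?mulr_ge0 ?sqr_ge0//; lra.
have i0 : 0 <= i by move: I0; rewrite -Ei lee_fin.
have ss0 : 0 < s ^+ 2 by rewrite exprn_gt0.
apply/eqP; rewrite eq_le; apply/andP; split; rewrite leNgt; apply/negP => hlt.
- pose d := i / s ^+ 2 - 1.
  have Eid : i = s ^+ 2 * (1 + d) by rewrite /d; field; rewrite gt_eqF.
  have d0 : 0 < d by rewrite /d subr_gt0 ltr_pdivlMr// mul1r.
  (* At [r = 1 + e] the bound [up'] becomes [2 d + d e <= 3 e + 2 e^2], while [e <= 1/2] and
     [e <= d / 4] bound the right side by [4 e <= d]. *)
  pose e := Num.min (d / 4) (1 / 2).
  have [e1 e2] : e <= d / 4 /\ e <= 1 / 2 by rewrite !ge_min !lexx orbT.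
  have e0 : 0 < e by rewrite lt_min !divr_gt0.
  have /up' : 1 < 1 + e by lra.
  have -> : i * (1 + e + 1) = s ^+ 2 * ((1 + d) * (2 + e)) by rewrite Eid; ring.
  rewrite (mulrC _ (s ^+ 2)) ler_pM2l//.
  have : 0 <= d * e by rewrite mulr_ge0 ?ltW.
  have : 0 <= e * (1 / 2 - e) by apply: mulr_ge0; lra.
  by lra.
- pose d := 1 - i / s ^+ 2.
  have Eid : i = s ^+ 2 * (1 - d) by rewrite /d; field; rewrite gt_eqF.
  have d0 : 0 < d by rewrite /d subr_gt0 ltr_pdivrMr// mul1r.
  have d1 : d <= 1 by rewrite /d lerBlDr lerDl divr_ge0 ?(ltW ss0).
  pose e := d / 4.
  have /dn' : 0 < 1 - e < 1 by apply/andP; split; rewrite /e; lra.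
  have -> : i * (1 - e + 1) = s ^+ 2 * ((1 - d) * (2 - e)) by rewrite Eid; ring.
  rewrite (mulrC _ (s ^+ 2)) ler_pM2l// /e.
  have : 0 <= d * (1 - d) by apply: mulr_ge0; lra.
  have : 0 <= d * d by rewrite mulr_ge0 ?ltW.
  by lra.
Qed.

(** Expanding the square produces the odd term [2 w a (x - m)], which is not of constant sign.
    Reflection about [m] shows that [w] and [- w] give the same integral, and in the sum of the two
    the odd terms cancel. *)
Lemma ge0_integral_normal_affine_sqr (m s w a k : R) : 0 < s -> 0 <= k ->
  (\int[leb]_x (normal_pdf m s x * (k + (w * (x - m) + a) ^+ 2))%:E =
   (k + a ^+ 2 + w ^+ 2 * s ^+ 2)%:E)%E.
Proof.
move=> s0 k0.
pose f w x := normal_pdf m s x * (k + (w * (x - m) + a) ^+ 2).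
have mp : measurable_fun [set: R] (normal_pdf m s) by exact: measurable_normal_pdf.
have mxm : measurable_fun [set: R] (fun x => x - m).
  by apply: measurable_funB => //; exact: measurable_cst.
have mf w' : measurable_fun [set: R] (fun x => (f w' x)%:E).
  apply/measurable_EFinP; apply: measurable_funM => //.
  apply: measurable_funD; first exact: measurable_cst.
  apply: measurable_funX; apply: measurable_funD; last exact: measurable_cst.
  by apply: measurable_funM => //; exact: measurable_cst.
have f0 w' x : 0 <= f w' x.
  by rewrite mulr_ge0 ?normal_pdf_ge0// addr_ge0 ?sqr_ge0.
have fw : (\int[leb]_x (f w x)%:E = \int[leb]_x (f (- w) x)%:E)%E.
  rewrite (ge0_integral_reflect (m + m) (mf w)) => [|x]; last by rewrite lee_fin.
  apply: eq_integral => x _; congr EFin; rewrite /f !normal_pdfE ?gt_eqF//.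
  rewrite /normal_fun; congr (_ * expR _ * _); last by congr (_ + _); ring.
  by congr (_ / _); ring.
have sum : (\int[leb]_x (f w x)%:E + \int[leb]_x (f (- w) x)%:E =
    (2 * (k + a ^+ 2 + w ^+ 2 * s ^+ 2))%:E)%E.
  rewrite -ge0_integralD//; last 4 first.
  - by move=> x _; rewrite lee_fin.
  - exact: mf.
  - by move=> x _; rewrite lee_fin.
  - exact: mf.
  transitivity (\int[leb]_x ((2 * (k + a ^+ 2))%:E * (normal_pdf m s x)%:E +
     (2 * w ^+ 2)%:E * (normal_pdf m s x * (x - m) ^+ 2)%:E))%E.
    by apply: eq_integral => x _; rewrite -EFinD -!EFinM -EFinD /f; congr EFin; ring.
  have c1 : 0 <= 2 * (k + a ^+ 2) by rewrite mulr_ge0// addr_ge0// sqr_ge0.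
  have c2 : 0 <= 2 * w ^+ 2 by rewrite mulr_ge0// sqr_ge0.
  have mpq : measurable_fun [set: R] (fun x => (normal_pdf m s x * (x - m) ^+ 2)%:E).
    by apply/measurable_EFinP; apply: measurable_funM => //; exact: measurable_funX.
  have mpE : measurable_fun [set: R] (fun x => (normal_pdf m s x)%:E).
    exact/measurable_EFinP.
  have p0 x : (0 <= (normal_pdf m s x)%:E)%E by rewrite lee_fin normal_pdf_ge0.
  have pq0 x : (0 <= (normal_pdf m s x * (x - m) ^+ 2)%:E)%E.
    by rewrite lee_fin mulr_ge0 ?normal_pdf_ge0 ?sqr_ge0.
  rewrite ge0_integralD//; last 4 first.
  - by move=> x _; rewrite mule_ge0.
  - exact: measurable_funeM.
  - by move=> x _; rewrite mule_ge0.
  - exact: measurable_funeM.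
  rewrite !ge0_integralZl_EFin// integral_normal_pdf ge0_integral_normal_sqr// mule1.
  by rewrite -EFinM -EFinD; congr EFin; ring.
rewrite -fw in sum.
have : (0 <= \int[leb]_x (f w x)%:E)%E by apply: integral_ge0 => x _; rewrite lee_fin.
move: sum; rewrite -/(f w).
change (\int[leb]_x (normal_pdf m s x * (k + (w * (x - m) + a) ^+ 2))%:E)%E
  with (\int[leb]_x (f w x)%:E)%E.
case: (integral _ _ _) => [r| |] //=.
by rewrite -EFinD => -[h] _; congr EFin; lra.
Qed.

End normal_moments.

Section gaussian_moments.
Context {R : realType}.

Lemma gauss_pdf1 (mu : 'cV[R]_1) (K : 'M[R]_1) (x : R) : 0 < K 0 0 ->
  gauss_pdf mu K x%:M = normal_pdf (mu 0 0) (Num.sqrt (K 0 0)) x.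
Proof.
move=> K0; have s0 : 0 < Num.sqrt (K 0 0) by rewrite sqrtr_gt0.
rewrite normal_pdfE ?gt_eqF// /gauss_pdf /normal_peak /normal_fun sqr_sqrtr ?ltW//.
rewrite expr1 [K]mx11_scalar det_scalar1 invmx_scalar.
congr (_ * expR _).
  rewrite -invfM -sqrtrM ?mulr_ge0 ?pi_ge0//; congr (Num.sqrt _)^-1.
  by rewrite mxE eqxx mulr1n; ring.
rewrite mul_mx_scalar -scalemxAl mxE mxE big_ord1 !mxE eqxx !mulr1n.
by field; rewrite gt_eqF.
Qed.

Lemma gauss_pdf_ge0 N (mu : 'cV[R]_N) K z : 0 <= gauss_pdf mu K z.
Proof.
by rewrite /gauss_pdf mulr_ge0 ?expR_ge0// divr_ge0 ?sqrtr_ge0// invr_ge0 exprn_ge0 ?sqrtr_ge0.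
Qed.

(** The shape of the integrand is chosen to survive the induction: integrating out the first
    coordinate replaces [k] by [k + wx^2 W] and [w] by [G^T wx + wy], with [a] unchanged. Total mass
    ([w = 0], [a = 0], [k = 1]) and second moments are both instances. *)
Lemma intV_gauss_affine_sqr N (mu : 'cV[R]_N) K (w : 'cV[R]_N) a k :
  posdef K -> 0 <= k ->
  intV (fun z => (gauss_pdf mu K z * (k + ((w^T *m (z - mu)) 0 0 + a) ^+ 2))%:E) =
  (k + a ^+ 2 + quad K w)%:E.
Proof.
elim: N mu K w a k => [|N IH] mu K w a k pK k0.
  rewrite /intV /= /gauss_pdf det_mx00 expr0 sqrtr1 !flatmx0.
  by rewrite !mulmx0 mxE mulr0 expR0 invr1 !mul1r add0r /quad mulmx0 mxE addr0.
rewrite -[N.+1]/(1 + N)%N in mu K w pK *.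
have [G [W [S [-> pW pS]]]] := posdef_uschur_decomp pK; have W0 := posdef1_gt0 pW.
have mf (M : 'M[R]_(1 + N)) : mfunV (fun z : 'cV_(1 + N)%N =>
    (gauss_pdf mu M z * (k + ((w^T *m (z - mu)) 0 0 + a) ^+ 2))%:E).
  apply: mfunV_EFin; apply: measurable_funM; first exact: measV_gauss.
  apply: measurable_funD; first exact: measurable_cst.
  apply: measurable_funX; apply: measurable_funD; last exact: measurable_cst.
  apply: mmap_mulmx; apply: mmapB; [exact: mmap_tup2col|exact: mmap_cst].
rewrite intV_swap//; last first.
  by move=> z; rewrite lee_fin mulr_ge0 ?gauss_pdf_ge0// addr_ge0// sqr_ge0.
rewrite -(vsubmxK mu) -(vsubmxK w).
move: (usubmx mu) (dsubmx mu) (usubmx w) (dsubmx w) => mx my wx wy.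
have H0 : 0 <= k + wx 0 0 ^+ 2 * W 0 0 by rewrite addr_ge0// mulr_ge0 ?sqr_ge0 ?ltW.
have := IH my S (G^T *m wx + wy) a _ pS H0.
rewrite quad_uschur (_ : quad W wx = wx 0 0 ^+ 2 * W 0 0); last first.
  rewrite /quad [W in LHS]mx11_scalar mul_mx_scalar -scalemxAl mxE [in LHS]mxE big_ord1 mxE.
  by rewrite expr2 mulrC.
move: (quad S _) => qS.
rewrite (_ : k + a ^+ 2 + (_ + qS) = k + wx 0 0 ^+ 2 * W 0 0 + a ^+ 2 + qS); last by ring.
move=> <-.
apply: eq_intV => y; rewrite intV1.
pose b : 'cV[R]_1 := G *m (y - my).
(* The value of the affine form when [x] equals its conditional mean [mx + b] given [y]. *)
pose a' := wx 0 0 * b 0 0 + (wy^T *m (y - my)) 0 0 + a.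
transitivity (\int[lebesgue_measure]_x ((gauss_pdf my S y)%:E *
    (normal_pdf ((mx + b) 0 0) (Num.sqrt (W 0 0)) x *
     (k + (wx 0 0 * (x - (mx + b) 0 0) + a') ^+ 2))%:E))%E.
  apply: eq_integral => x _; rewrite -EFinM; congr EFin.
  rewrite gauss_pdf_uschur// gauss_pdf1// -/b -mulrA mulrCA.
  congr (_ * (_ * (_ + _ ^+ 2))).
  rewrite opp_col_mx add_col_mx tr_col_mx mul_row_col mxE [X in X + _ + _]mxE big_ord1.
  by rewrite /a' !mxE eqxx mulr1n; ring.
rewrite ge0_integralZl_EFin//; last 3 first.
- by move=> x _; rewrite lee_fin mulr_ge0 ?normal_pdf_ge0// addr_ge0// sqr_ge0.
- have h : measurable_fun [set: R] (fun x : R => (normal_pdf ((mx + b) 0 0) (Num.sqrt (W 0 0)) x *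
     (k + (wx 0 0 * (x - (mx + b) 0 0) + a') ^+ 2))%:E).
    apply/measurable_EFinP; apply: measurable_funM; first exact: measurable_normal_pdf.
    apply: measurable_funD; first exact: measurable_cst.
    apply: measurable_funX; apply: measurable_funD; last exact: measurable_cst.
    apply: measurable_funM; first exact: measurable_cst.
    by apply: measurable_funB => //; exact: measurable_cst.
  exact: h.
- exact: gauss_pdf_ge0.
rewrite ge0_integral_normal_affine_sqr ?sqrtr_gt0// sqr_sqrtr ?ltW// -EFinM.
congr EFin; congr (_ * _).
rewrite [X in _ = X](_ : _ = k + wx 0 0 ^+ 2 * W 0 0 + a' ^+ 2); first by ring.
have -> : (G^T *m wx + wy)^T = wx^T *m G + wy^T by rewrite linearD /= trmx_mul trmxK.
rewrite /a' /b mulmxDl -mulmxA; congr (_ + (_ + _) ^+ 2).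
by rewrite [LHS]mxE [X in X + _ = _]mxE big_ord1 [X in X * _ + _ = _]mxE.
Qed.

Lemma intV_gauss_pdf N (mu : 'cV[R]_N) K : posdef K ->
  intV (fun z => (gauss_pdf mu K z)%:E) = 1%E.
Proof.
move=> pK; have := @intV_gauss_affine_sqr N mu K 0 0 1 pK ler01.
rewrite expr0n addr0 quad0 addr0 => <-; apply: eq_intV => z.
by rewrite trmx0 mul0mx mxE addr0 expr0n addr0 mulr1.
Qed.

Lemma gauss_density N (mu : 'cV[R]_N) K : posdef K -> is_density (gauss_pdf mu K).
Proof.
move=> pK; split; first exact: measV_gauss.
  by move=> z; exact: gauss_pdf_ge0.
exact: intV_gauss_pdf.
Qed.

Lemma intV_sum N n (f : 'I_n -> 'cV[R]_N -> R) :
  (forall i, measV (f i)) -> (forall i z, 0 <= f i z) ->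
  intV (fun z => (\sum_i f i z)%:E) = (\sum_i intV (fun z => (f i z)%:E))%E.
Proof.
elim: n f => [|n IH] f mf f0.
  rewrite big_ord0 -[RHS](mul0e (intV (fun _ : 'cV[R]_N => 1%E))) -intVZ//.
    by apply: eq_intV => z; rewrite big_ord0 mul0e.
  exact: measurable_cst.
rewrite big_ord_recl -IH//.
rewrite -intVD//.
- by apply: eq_intV => z; rewrite big_ord_recl EFinD.
- exact: mfunV_EFin.
- by apply: mfunV_EFin; apply: measurable_sum => i; exact: mf.
- by move=> z; rewrite lee_fin.
- by move=> z; rewrite lee_fin sumr_ge0.
Qed.

(** Each coordinate of [H (z - mu) + b] is an affine form in [z], so [intV_gauss_affine_sqr] applies
    to each row of [H]; [b] will be the bias of an estimator. *)
Lemma intV_gauss_sqnorm N n (H : 'M[R]_(n, N)) (mu : 'cV[R]_N) K (b : 'cV[R]_n) :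
  posdef K ->
  intV (fun z => (1 / 2 * sqnorm (H *m (z - mu) + b) * gauss_pdf mu K z)%:E) =
  (1 / 2 * (\tr (H *m K *m H^T) + sqnorm b))%:E.
Proof.
move=> pK.
pose f i z := gauss_pdf mu K z * (0 + (((row i H)^T^T *m (z - mu)) 0 0 + b i 0) ^+ 2).
have mf i : measV (f i).
  apply: measurable_funM; first exact: measV_gauss.
  apply: measurable_funD; first exact: measurable_cst.
  apply: measurable_funX; apply: measurable_funD; last exact: measurable_cst.
  apply: mmap_mulmx; apply: mmapB; [exact: mmap_tup2col|exact: mmap_cst].
have f0 i z : 0 <= f i z by rewrite mulr_ge0 ?gauss_pdf_ge0// add0r sqr_ge0.
transitivity (intV (fun z => (1 / 2)%:E * (\sum_i f i z)%:E)%E).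
  apply: eq_intV => z; rewrite -EFinM -mulrA; congr ((_ * _)%:E).
  rewrite mulrC mulr_sumr; apply: eq_bigr => i _; rewrite /f add0r trmxK.
  by rewrite mxE [in RHS]mxE [in LHS]mxE; under [in RHS]eq_bigr do rewrite mxE.
rewrite intVZ//; last 2 first.
- by apply: mfunV_EFin; apply: measurable_sum => i; exact: mf.
- by move=> z; rewrite lee_fin sumr_ge0.
rewrite intV_sum// [RHS]EFinM; congr (_ * _)%E.
under eq_bigr do rewrite intV_gauss_affine_sqr// add0r.
rewrite sumEFin; congr EFin; rewrite big_split /= addrC; congr (_ + _).
apply: eq_bigr => i _; rewrite /quad trmxK -row_mul mxE [RHS]mxE.
by apply: eq_bigr => j _; rewrite !mxE.
Qed.

End gaussian_moments.

(** * Relative entropy *)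

Section relative_entropy.
Context {R : realType} (N : nat).
Implicit Types p f q : 'cV[R]_N -> R.

Lemma measV_KL p f : measV p -> (forall z, 0 < p z) -> measV f ->
  measV (fun z => f z * ln (f z / p z)).
Proof.
move=> mp p0 mf; apply: measurable_funM => //.
apply: measurableT_comp; first exact: measurable_ln.
apply: measurable_funM => //.
(* The reciprocal of [p] is measurable as [exp (- ln p)]; this uses [0 < p]. *)
rewrite (_ : (fun _ => _) = (fun t => expR (- ln (p (tup2col t))))).
  apply: measurableT_comp; first exact: measurable_expR.
  by apply: measurable_funN; apply: measurableT_comp => //; exact: measurable_ln.
by apply/funext => t; rewrite expRN lnK// posrE.
Qed.

Lemma mfunV_pos f : measV f -> mfunV (fun z => (Num.max (f z) 0)%:E).
Proof.
move=> mf; rewrite /mfunV; under eq_fun do rewrite EFin_max.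
by apply: measurable_maxe; [exact/measurable_EFinP|exact: measurable_cst].
Qed.

(* [f ln (f / p) - f (q - k) = f ln (f / h)] with [h = p e^(q - k)], and
   [ln x <= x - 1] at [x = h / f]. *)
Lemma gibbs_pointwise (f p q k : R) : 0 <= f -> 0 < p ->
  f * q + Num.max (- (f * ln (f / p))) 0 + f <=
  Num.max (f * ln (f / p)) 0 + p * expR (q - k) + k * f.
Proof.
rewrite le_eqVlt => /predU1P[<- p0|f0 p0].
  by rewrite !mul0r mulr0 oppr0 maxxx !add0r addr0 mulr_ge0 ?expR_ge0 ?ltW.
suff : f * (1 + (q - k - ln (f / p))) <= p * expR (q - k).
  set l := f * ln (f / p) => h.
  have {}h : f + f * q - k * f - l <= p * expR (q - k) by move: h; rewrite /l; lra.
  have -> : Num.max l 0 = l + Num.max (- l) 0.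
    by rewrite !maxEle oppr_le0; case: (lerP l 0) => l0; case: (lerP 0 l) => l1; lra.
  lra.
have -> : p * expR (q - k) = f * expR (q - k - ln (f / p)).
  rewrite [in RHS]expRD expRN lnK ?posrE ?divr_gt0//.
  by field; rewrite !gt_eqF.
by rewrite ler_pM2l// expR_ge1Dx.
Qed.

(** [gibbs_pointwise] with [q = k = 0] bounds the negative part by [p] pointwise. Hence [KL] is
    never of the form [+oo - +oo], and an upper bound on it controls the positive part. *)
Lemma KL_neg_fin p f : is_density p -> (forall z, 0 < p z) -> is_density f ->
  (intV (fun z => (Num.max (- (f z * ln (f z / p z))) 0)%:E) <= 1)%E.
Proof.
move=> [mp _ p1] p0 [mf f0 f1]; rewrite -p1; apply: le_intV.
- apply: mfunV_pos; apply: measurable_funN; exact: measV_KL.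
- exact: mfunV_EFin.
- by move=> z; rewrite lee_fin le_max lexx orbT.
- move=> z; rewrite lee_fin ge_max (ltW (p0 z)) andbT.
  have := @gibbs_pointwise (f z) (p z) 0 0 (f0 z) (p0 z).
  rewrite mulr0 add0r subrr expR0 mulr1 mul0r addr0.
  set l := f z * _; have := f0 z; rewrite !maxEle oppr_le0.
  by case: (lerP l 0) => l0; case: (lerP 0 l) => l1; lra.
Qed.

(** The mass [M] of the tilt is left free for two uses: [M = 1] with [k] the log-normaliser gives
    the saddle inequality, and [k = 0] with an unnormalised tilt gives finiteness of second
    moments. *)
Lemma gibbs_bound p f q k c M : is_density p -> (forall z, 0 < p z) ->
  ambiguity p c f -> measV q -> (forall z, 0 <= q z) -> 0 <= k ->
  intV (fun z => (p z * expR (q z - k))%:E) = M%:E ->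
  (intV (fun z => (f z * q z)%:E) <= (c + k + M - 1)%:E)%E.
Proof.
move=> dp p0 [df KLc] mq q0 k0 hM; have negle := KL_neg_fin dp p0 df.
case: (df) => mf f0 f1; case: dp => mp _ p1.
move: KLc; rewrite /KL /intVs.
pose l z := f z * ln (f z / p z).
have ml : measV l by exact: measV_KL.
have mpos := mfunV_pos ml.
have mneg : mfunV (fun z => (Num.max (- l z) 0)%:E).
  by apply: mfunV_pos; exact: measurable_funN.
have mfq : mfunV (fun z => (f z * q z)%:E) by apply: mfunV_EFin; exact: measurable_funM.
have mh : mfunV (fun z => (p z * expR (q z - k))%:E).
  apply: mfunV_EFin; apply: measurable_funM => //.
  apply: measurableT_comp; first exact: measurable_expR.
  by apply: measurable_funB => //; exact: measurable_cst.
have mkf : mfunV (fun z => (k * f z)%:E).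
  by apply: mfunV_EFin; apply: measurable_funM => //; exact: measurable_cst.
have max0 (x : R) : (0 <= (Num.max x 0)%:E)%E by rewrite lee_fin le_max lexx orbT.
have fq0 z : (0 <= (f z * q z)%:E)%E by rewrite lee_fin mulr_ge0.
have h0 z : (0 <= (p z * expR (q z - k))%:E)%E by rewrite lee_fin mulr_ge0 ?expR_ge0 ?ltW.
have kf0 z : (0 <= (k * f z)%:E)%E by rewrite lee_fin mulr_ge0.
have fE0 z : (0 <= (f z)%:E)%E by rewrite lee_fin.
have kfE : intV (fun z => (k * f z)%:E) = k%:E.
  under eq_intV => z do rewrite EFinM.
  by rewrite intVZ ?f1 ?mule1//; exact: mfunV_EFin.
(* The integrated form of [gibbs_pointwise]. All six terms are integrals of nonnegative functions,
   so additivity holds before anything is known to be finite. *)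
have main : (intV (fun z => (f z * q z)%:E) + intV (fun z => (Num.max (- l z) 0)%:E) + 1 <=
   intV (fun z => (Num.max (l z) 0)%:E) + M%:E + k%:E)%E.
  rewrite -hM -kfE -f1 -!intVD//; last 5 first.
  - exact: emeasurable_funD.
  - by move=> z; rewrite adde_ge0.
  - exact: emeasurable_funD.
  - exact: mfunV_EFin.
  - by move=> z; rewrite adde_ge0.
  apply: le_intV.
  - apply: emeasurable_funD; last exact: mfunV_EFin.
    exact: emeasurable_funD.
  - by apply: emeasurable_funD => //; exact: emeasurable_funD.
  - by move=> z; rewrite !adde_ge0.
  - by move=> z; rewrite -!EFinD lee_fin; exact: gibbs_pointwise.
move: negle main; rewrite -/(l _).
have := intV_ge0 (fun z => max0 (- l z)); have := intV_ge0 (fun z => max0 (l z)).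
have := intV_ge0 fq0.
change (intV (fun z => (Num.max (- (f z * ln (f z / p z))) 0)%:E)) with
  (intV (fun z => (Num.max (- l z) 0)%:E)).
change (intV (fun z => (Num.max (f z * ln (f z / p z)) 0)%:E)) with
  (intV (fun z => (Num.max (l z) 0)%:E)).
(* An infinite positive part contradicts the bound on [KL], the negative part being at most 1; an
   infinite mean of [q] then contradicts [main]. *)
case: (intV (fun z => (Num.max (l z) 0)%:E)) => [a| |] //;
case: (intV (fun z => (Num.max (- l z) 0)%:E)) => [b| |] //;
case: (intV (fun z => (f z * q z)%:E)) => [d| |] //=.
by rewrite -!EFinD !lee_fin => *; lra.
Qed.

(** The log-likelihood ratio of the tilt to [p] is exactly [q - k], so the divergence is the tilted
    mean of [q] minus [k]. The pointwise identity is again split into nonnegative terms before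
    integration. *)
Lemma KL_tilt p q k a : is_density p -> (forall z, 0 < p z) ->
  measV q -> (forall z, 0 <= q z) -> 0 <= k ->
  is_density (fun z => p z * expR (q z - k)) ->
  intV (fun z => (p z * expR (q z - k) * q z)%:E) = a%:E ->
  KL (fun z => p z * expR (q z - k)) p = (a - k)%:E.
Proof.
set h := fun z => _; move=> dp p0 mq q0 k0 dh ha.
have negle := KL_neg_fin dp p0 dh.
case: (dh) => mh h0 h1; case: dp => mp _ p1.
rewrite /KL /intVs.
pose l z := h z * ln (h z / p z).
have lE z : l z = h z * q z - k * h z.
  rewrite /l (_ : h z / p z = expR (q z - k)); last first.
    by rewrite /h mulrAC divff ?mul1r ?gt_eqF.
  by rewrite expRK; ring.
have ml : measV l by exact: measV_KL.
have mpos := mfunV_pos ml.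
have mneg : mfunV (fun z => (Num.max (- l z) 0)%:E).
  by apply: mfunV_pos; exact: measurable_funN.
have max0 (x : R) : (0 <= (Num.max x 0)%:E)%E by rewrite lee_fin le_max lexx orbT.
have mfq : mfunV (fun z => (h z * q z)%:E) by apply: mfunV_EFin; exact: measurable_funM.
have mkf : mfunV (fun z => (k * h z)%:E).
  by apply: mfunV_EFin; apply: measurable_funM => //; exact: measurable_cst.
have fq0 z : (0 <= (h z * q z)%:E)%E by rewrite lee_fin mulr_ge0.
have kf0 z : (0 <= (k * h z)%:E)%E by rewrite lee_fin mulr_ge0.
have kfE : intV (fun z => (k * h z)%:E) = k%:E.
  under eq_intV => z do rewrite EFinM.
  by rewrite intVZ ?h1 ?mule1//; exact: mfunV_EFin.
have main : (a%:E + intV (fun z => (Num.max (- l z) 0)%:E) =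
   intV (fun z => (Num.max (l z) 0)%:E) + k%:E)%E.
  rewrite -ha -kfE -!intVD//; apply: eq_intV => z.
  rewrite -!EFinD; congr EFin; rewrite !maxEle oppr_le0; have := lE z.
  move: (h z * q z) (k * h z) (l z) => u v w Ew.
  by case: (lerP w 0) => l0; case: (lerP 0 w) => l1; lra.
move: negle main.
have := intV_ge0 (fun z => max0 (- l z)); have := intV_ge0 (fun z => max0 (l z)).
change (intV (fun z => (Num.max (- (h z * ln (h z / p z))) 0)%:E)) with
  (intV (fun z => (Num.max (- l z) 0)%:E)).
change (intV (fun z => (Num.max (h z * ln (h z / p z)) 0)%:E)) with
  (intV (fun z => (Num.max (l z) 0)%:E)).
case: (intV (fun z => (Num.max (l z) 0)%:E)) => [x| |] //;
case: (intV (fun z => (Num.max (- l z) 0)%:E)) => [b| |] //=.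
by rewrite -!EFinD => _ _ _ [e]; congr EFin; lra.
Qed.

End relative_entropy.

(** * The saddle point *)

Section saddle_point.
Context {R : realType}.

Lemma quad_sym N (M : 'M[R]_N) (x y : 'cV[R]_N) : M^T = M ->
  quad M (x + y) = quad M x + 2 * (x^T *m M *m y) 0 0 + quad M y.
Proof.
move=> sM; rewrite /quad [(x + y)^T]linearD /= mulmxDl mulmxDr !mulmxDl.
rewrite [LHS]mxE [X in X + _ = _]mxE [X in _ + X = _]mxE.
have -> : (y^T *m M *m x) 0 0 = (x^T *m M *m y) 0 0.
  transitivity ((y^T *m M *m x)^T 0 0); first by rewrite [RHS]mxE.
  by rewrite !trmx_mul trmxK sM mulmxA.
by ring.
Qed.

Lemma quad_scale N (M : 'M[R]_N) (t : R) (x : 'cV[R]_N) :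
  quad M (t *: x) = t ^+ 2 * quad M x.
Proof.
rewrite /quad [(t *: x)^T]linearZ /= -!scalemxAl -scalemxAr mxE [X in _ * X]mxE.
by rewrite mulrA expr2.
Qed.

(* [0 <= quad (invmx K) (z - t K v)] at the minimising [t = v.z / quad K v] *)
Lemma posdef_cauchy_schwarz N (K : 'M[R]_N) (v z : 'cV[R]_N) : posdef K ->
  ((v^T *m z) 0 0) ^+ 2 <= quad K v * quad (invmx K) z.
Proof.
move=> pK; have [sK hK] := pK; have uK := posdef_unit pK.
have [->|v0] := eqVneq v 0.
  by rewrite trmx0 mul0mx mxE expr0n /= quad0 mul0r.
have a0 : 0 < quad K v by exact: hK.
set a := quad K v in a0 *; set b := (v^T *m z) 0 0.
have := posdef_ge0 (z + (- (b / a)) *: (K *m v)) (posdef_inv pK).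
rewrite quad_sym; last by rewrite trmx_inv sK.
have -> : (z^T *m invmx K *m ((- (b / a)) *: (K *m v))) 0 0 = - (b / a) * b.
  rewrite -scalemxAr mxE -mulmxA mulKmx//; congr (_ * _).
  transitivity ((z^T *m v)^T 0 0); first by rewrite [RHS]mxE.
  by rewrite trmx_mul trmxK.
have -> : quad (invmx K) (- (b / a) *: (K *m v)) = (b / a) ^+ 2 * a.
  rewrite quad_scale sqrrN /quad trmx_mul sK; congr (_ * _).
  by rewrite -!mulmxA mulKmx// mulmxA.
have -> : quad (invmx K) z + 2 * (- (b / a) * b) + (b / a) ^+ 2 * a =
    quad (invmx K) z - b ^+ 2 / a by field; rewrite gt_eqF.
by rewrite subr_ge0 ler_pdivrMr// mulrC.
Qed.

(** Cauchy-Schwarz for each row of [E], summed: the values of [quad K] at the rows add up to the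
    trace. Moments of linear images are thereby controlled by the single moment of
    [quad (invmx K)]. *)
Lemma sqnorm_le_quad N n (K : 'M[R]_N) (E : 'M[R]_(n, N)) z : posdef K ->
  sqnorm (E *m z) <= \tr (E *m K *m E^T) * quad (invmx K) z.
Proof.
move=> pK; rewrite mulr_suml; apply: ler_sum => i _.
have := posdef_cauchy_schwarz (row i E)^T z pK.
rewrite trmxK /quad trmxK -!row_mul !mxE; congr (_ <= _ * _).
by apply: eq_bigr => j _; rewrite !mxE.
Qed.

Lemma trace_quad N n (K : 'M[R]_N) (E : 'M[R]_(n, N)) : posdef K -> 0 <= \tr (E *m K *m E^T).
Proof.
move=> pK; apply: sumr_ge0 => i _.
have := posdef_ge0 (row i E)^T pK; rewrite /quad trmxK -row_mul.
rewrite !mxE => /le_trans; apply; rewrite le_eqVlt; apply/orP; left; apply/eqP.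
by apply: eq_bigr => j _; rewrite !mxE.
Qed.

(** As [q >= 0], the tilt dominates [exp (- k) p], and both [p] and the tilt have mass 1.
    [gibbs_bound] needs this sign because it integrates [k f] as a nonnegative function. *)
Lemma tilt_ge0 N (p q : 'cV[R]_N -> R) k : is_density p -> measV q ->
  (forall z, 0 <= q z) -> is_density (fun z => p z * expR (q z - k)) -> 0 <= k.
Proof.
move=> [mp p0 p1] mq q0 [mh h0 h1].
have : (intV (fun z => (expR (- k))%:E * (p z)%:E)%E <= 1)%E.
  rewrite -h1; apply: le_intV.
  - by apply: measurable_funeM; exact: mfunV_EFin.
  - exact: mfunV_EFin.
  - by move=> z; rewrite -EFinM lee_fin mulr_ge0 ?expR_ge0.
  - by move=> z; rewrite -EFinM lee_fin mulrC ler_wpM2l// ler_expR lerDr.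
rewrite (intVZ (mfunV_EFin mp)) ?expR_ge0//.
by rewrite p1 mule1 lee_fin -[leRHS]expR0 ler_expR oppr_le0.
Qed.

Context (n p m : nat).
Variables (G : 'M[R]_(p, m)) (S : 'M[R]_m) (mx : 'cV[R]_p) (my : 'cV[R]_m).
Hypothesis pS : posdef S.
Let g0 (y : 'cV[R]_m) : 'cV[R]_p := mx + G *m (y - my).
Let mz := col_mx mx my.

Section conditional.
Variable W : 'M[R]_p.
Hypothesis pW : posdef W.
Let f := gauss_pdf mz (uschur G W S).

(** The result does not depend on [W]: the nominal law ([W = P]) and the tilted law ([W = V1]) give
    [y] the same distribution. *)
Lemma marg_gauss y : marg f y = (gauss_pdf my S y)%:E.
Proof.
rewrite /marg -[RHS]mule1 -(intV_gauss_pdf (g0 y) pW) -intVZ ?gauss_pdf_ge0//; last 2 first.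
- by apply: mfunV_EFin; exact: measV_gauss.
- by move=> z; rewrite lee_fin gauss_pdf_ge0.
by apply: eq_intV => x; rewrite /f gauss_pdf_uschur// -EFinM mulrC.
Qed.

Lemma marg_gauss_fin y : (0 < marg f y < +oo)%E.
Proof. by rewrite marg_gauss lte_fin gauss_pdf_gt0//= ltry. Qed.

Lemma cond_density_gauss y x : cond_density f y x = gauss_pdf (g0 y) W x.
Proof.
rewrite /cond_density marg_gauss /f gauss_pdf_uschur//= mulfK//.
by rewrite gt_eqF// gauss_pdf_gt0.
Qed.

Lemma measV_cost (H : 'M[R]_(n, p)) (g : 'cV[R]_m -> 'cV[R]_p) :
  (forall i, measV (fun y => g y i 0)) ->
  measV (fun z => sqnorm (H *m (usubmx z - g (dsubmx z)))).
Proof.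
move=> mg; rewrite /measV; under eq_fun do rewrite sqnormE.
have mF : mmap (fun t : (p + m).-tuple R =>
    H *m (usubmx (tup2col t) - g (dsubmx (tup2col t)))).
  apply: mmap_mulmx; apply: mmapB; first by apply: mmap_usubmx; exact: mmap_tup2col.
  move=> i; apply: (measV_comp (mg i)).
  by apply: mmap_dsubmx; exact: mmap_tup2col.
exact: mmap_dot.
Qed.

(** Bias-variance decomposition given [y], from [x - g y = (x - g0 y) + (g0 y - g y)]: the estimator
    enters only through the bias. *)
Lemma Jcost_gauss (H : 'M[R]_(n, p)) (g : 'cV[R]_m -> 'cV[R]_p) :
  (forall i, measV (fun y => g y i 0)) ->
  Jcost H f g = intV (fun y => (gauss_pdf my S y *
    (1 / 2 * (\tr (H *m W *m H^T) + sqnorm (H *m (g0 y - g y)))))%:E).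
Proof.
move=> mg; rewrite /Jcost intV_swap; last 2 first.
- apply: mfunV_EFin; apply: measurable_funM; last exact: measV_gauss.
  apply: measurable_funM; first exact: measurable_cst.
  exact: measV_cost.
- by move=> z; rewrite lee_fin !mulr_ge0 ?sqnorm_ge0 ?gauss_pdf_ge0.
apply: eq_intV => y; rewrite EFinM -(intV_gauss_sqnorm H (g0 y) (H *m (g0 y - g y)) pW).
rewrite -intVZ ?gauss_pdf_ge0//; last 2 first.
- apply: mfunV_EFin; apply: measurable_funM; last exact: measV_gauss.
  apply: measurable_funM; first exact: measurable_cst.
  rewrite /measV; under eq_fun do rewrite sqnormE.
  have mF : mmap (fun t : p.-tuple R => H *m (tup2col t - g0 y) + H *m (g0 y - g y)).
    apply: mmapD; last exact: mmap_cst.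
    by apply: mmap_mulmx; apply: mmapB; [exact: mmap_tup2col|exact: mmap_cst].
  exact: mmap_dot.
- by move=> z; rewrite lee_fin !mulr_ge0 ?sqnorm_ge0 ?gauss_pdf_ge0.
apply: eq_intV => x; rewrite -EFinM col_mxKu col_mxKd /f gauss_pdf_uschur//; congr EFin.
by rewrite -mulmxDr addrA subrK -/(g0 y); ring.
Qed.

End conditional.

Lemma measV_g0 i : measV (fun y => g0 y i 0).
Proof.
have h : mmap (fun t : m.-tuple R => g0 (tup2col t)).
  apply: mmapD; first exact: mmap_cst.
  by apply: mmap_mulmx; apply: mmapB; [exact: mmap_tup2col|exact: mmap_cst].
exact: h.
Qed.

Section tilted.
Variables (H : 'M[R]_(n, p)) (P : 'M[R]_p) (lt c : R).
Hypotheses (pP : posdef P) (lt0 : 0 < lt).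
Let V1 := invmx (invmx P - lt^-1 *: (H^T *m H)).
Hypothesis pV1 : posdef V1.
Let W := 1%:M - lt^-1 *: (H^T *m H *m P).
Hypothesis hc : 1 / 2 * (\tr (invmx W - 1%:M) + ln (\det W)) = c.
Let fbar := gauss_pdf mz (uschur G P S).
Let f0 := gauss_pdf mz (uschur G V1 S).
(** The log-normaliser [ln Z] of the tilt; [q] below already carries the factor [lt^-1]. *)
Let k := 1 / 2 * ln (\det V1 / \det P).
Let q z := lt^-1 * (1 / 2 * sqnorm (H *m (usubmx z - g0 (dsubmx z)))).

Let X := invmx P - lt^-1 *: (H^T *m H).

Let uX : X \in unitmx.
Proof. by rewrite -unitmx_inv; exact: posdef_unit. Qed.

Let WE : W = X *m P.
Proof. by rewrite /X mulmxBl mulVmx ?posdef_unit// -scalemxAl. Qed.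

Lemma det_tilt : \det W = \det P / \det V1.
Proof.
rewrite WE det_mulmx mulrC; congr (_ * _).
by rewrite /V1 det_inv invrK.
Qed.

(** From [W = X P] and [V1 = X^-1] one gets [W^-1 - 1 = (P^-1 - X) V1 = lt^-1 H^T H V1]; cyclicity
    of the trace does the rest. *)
Lemma trace_tilt : \tr (invmx W - 1%:M) = lt^-1 * \tr (H *m V1 *m H^T).
Proof.
have uP := posdef_unit pP.
have -> : invmx W = invmx P *m V1.
  have uW : W \in unitmx by rewrite WE unitmx_mul uX uP.
  rewrite -[RHS]mul1mx -(mulVmx uW) -[LHS]mulmx1 -!mulmxA; congr (_ *m _).
  by rewrite WE -mulmxA mulKVmx// mulmxV.
have -> : (1%:M : 'M[R]_p) = X *m V1 by rewrite mulmxV.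
rewrite -mulmxBl /X opprB addrC subrK -scalemxAl linearZ /= -mulmxA; congr (_ * _).
by rewrite -[in LHS]mulmxA mxtrace_mulC mulmxA.
Qed.

(** Here [gamma lt = c] is used: the left side is the cost of [g0] under [f0], the right side the
    bound that Gibbs' inequality gives over the whole ambiguity set. *)
Lemma tilt_const : 1 / 2 * \tr (H *m V1 *m H^T) = lt * (c + k).
Proof.
have dP := posdef_det_gt0 pP; have dV := posdef_det_gt0 pV1.
rewrite -hc trace_tilt det_tilt /k -(invf_div (\det V1)) lnV ?posrE ?divr_gt0//.
by field; rewrite gt_eqF.
Qed.

(** The factor in [y] is common to both densities. In the conditional factor the forms [invmx V1]
    and [invmx P] differ exactly by [lt^-1 H^T H], and the ratio of normalising constants is
    [exp (- k)]. *)
Lemma f0_tilt z : f0 z = fbar z * expR (q z - k).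
Proof.
have dP := posdef_det_gt0 pP; have dV := posdef_det_gt0 pV1.
rewrite -(vsubmxK z) /f0 /fbar !gauss_pdf_uschur// -/(g0 _) /q col_mxKu col_mxKd.
rewrite [RHS]mulrAC; congr (_ * _); rewrite /gauss_pdf -!/(quad _ _).
move: (Num.sqrt (2 * pi)) => e; set x := usubmx z - _.
have -> : quad (invmx V1) x = quad (invmx P) x - lt^-1 * sqnorm (H *m x).
  by rewrite /V1 invmxK quadD -scaleNr quadZ mulNr -[H^T]mulmx1 quad_mul /quad mulmx1 sqnormE.
have -> : expR (lt^-1 * (1 / 2 * sqnorm (H *m x)) - k) =
    expR (lt^-1 * (1 / 2 * sqnorm (H *m x))) * (Num.sqrt (\det P) / Num.sqrt (\det V1)).
  rewrite expRD; congr (_ * _); rewrite /k -mulrN -lnV ?posrE ?divr_gt0// invf_div.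
  rewrite -sqrtrV ?ltW// -sqrtrM ?ltW//.
  set t := \det P / \det V1; have t0 : 0 < t by rewrite divr_gt0.
  rewrite [X in ln X](_ : t = Num.sqrt t ^+ 2); last by rewrite sqr_sqrtr ?ltW.
  rewrite lnXn ?sqrtr_gt0//.
  have -> : 1 / 2 * (ln (Num.sqrt t) *+ 2) = ln (Num.sqrt t) by rewrite mulr2n; field.
  by rewrite lnK// posrE sqrtr_gt0.
have -> : - (1 / 2) * (quad (invmx P) x - lt^-1 * sqnorm (H *m x)) =
    - (1 / 2) * quad (invmx P) x + lt^-1 * (1 / 2 * sqnorm (H *m x)) by ring.
rewrite expRD.
have sP : Num.sqrt (\det P) != 0 by rewrite gt_eqF ?sqrtr_gt0.
move: (Num.sqrt (\det P)) sP (Num.sqrt (\det V1))^-1 (e ^- p) (expR _) (expR _) => a a0 b d u v.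
by field.
Qed.

Let pK : posdef (uschur G P S).
Proof. exact: posdef_uschur. Qed.

Let pK0 : posdef (uschur G V1 S).
Proof. exact: posdef_uschur. Qed.

Let f0E : f0 = fun z => fbar z * expR (q z - k).
Proof. by apply/funext => z; exact: f0_tilt. Qed.

Let mq : measV q.
Proof.
do 2 (apply: measurable_funM; first exact: measurable_cst).
by apply: measV_cost; exact: measV_g0.
Qed.

Let q0 z : 0 <= q z.
Proof. by rewrite !mulr_ge0 ?sqnorm_ge0 ?invr_ge0 ?(ltW lt0). Qed.

Let k0 : 0 <= k.
Proof.
apply: (tilt_ge0 (gauss_density mz pK) mq q0).
by rewrite -/fbar -f0E; exact: gauss_density.
Qed.

Let fbar0 z : 0 < fbar z.
Proof. exact: gauss_pdf_gt0. Qed.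

Lemma Jcost_f0_g0 : Jcost H f0 g0 = (lt * (c + k))%:E.
Proof.
rewrite Jcost_gauss//; last exact: measV_g0.
rewrite -tilt_const -[RHS]mule1 -(intV_gauss_pdf my pS) -intVZ; last 3 first.
- by apply: mfunV_EFin; exact: measV_gauss.
- by move=> z; rewrite lee_fin gauss_pdf_ge0.
- by rewrite mulr_ge0// trace_quad.
apply: eq_intV => y; rewrite -EFinM subrr mulmx0 mulrC.
congr (_ * _)%:E; congr (_ * _).
by rewrite (_ : sqnorm 0 = 0) ?addr0// /sqnorm big1// => i _; rewrite mxE expr0n.
Qed.

Lemma Jcost_f0_ge (g : 'cV[R]_m -> 'cV[R]_p) : (forall i, measV (fun y => g y i 0)) ->
  (Jcost H f0 g0 <= Jcost H f0 g)%E.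
Proof.
move=> mg; rewrite !Jcost_gauss//; last exact: measV_g0.
have mI (h : 'cV[R]_m -> 'cV[R]_p) : (forall i, measV (fun y => h y i 0)) -> mfunV (fun y =>
   (gauss_pdf my S y * (1 / 2 * (\tr (H *m V1 *m H^T) + sqnorm (H *m (g0 y - h y)))))%:E).
  move=> mh; apply: mfunV_EFin; apply: measurable_funM; first exact: measV_gauss.
  apply: measurable_funM; first exact: measurable_cst.
  apply: measurable_funD; first exact: measurable_cst.
  under eq_fun do rewrite sqnormE.
  have mF : mmap (fun t : m.-tuple R => H *m (g0 (tup2col t) - h (tup2col t))).
    by apply: mmap_mulmx; apply: mmapB => i; [exact: measV_g0|exact: mh].
  exact: mmap_dot.
have t0 := trace_quad H pV1.
apply: le_intV.
- by apply: mI; exact: measV_g0.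
- exact: mI.
- by move=> y; rewrite lee_fin !mulr_ge0 ?gauss_pdf_ge0// addr_ge0// sqnorm_ge0.
- move=> y; rewrite lee_fin ler_wpM2l ?gauss_pdf_ge0// ler_wpM2l// lerD2l subrr mulmx0.
  rewrite (_ : sqnorm 0 = 0) ?sqnorm_ge0// /sqnorm big1// => i _.
  by rewrite mxE expr0n.
Qed.

Lemma Jcost_g0_le f : ambiguity fbar c f -> (Jcost H f g0 <= Jcost H f0 g0)%E.
Proof.
move=> af; have [[mf f_ge0 _] _] := af.
have d0 : intV (fun z => (fbar z * expR (q z - k))%:E) = 1%E.
  by under eq_intV => z do rewrite -f0_tilt; exact: intV_gauss_pdf.
have := gibbs_bound (gauss_density mz pK) fbar0 af mq q0 k0 d0.
rewrite addrK Jcost_f0_g0 => h.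
have -> : Jcost H f g0 = (lt%:E * intV (fun z => (f z * q z)%:E))%E.
  rewrite -intVZ ?(ltW lt0)//; last 2 first.
  - by apply: mfunV_EFin; exact: measurable_funM.
  - by move=> z; rewrite lee_fin mulr_ge0.
  apply: eq_intV => z; rewrite -EFinM; congr EFin; rewrite /q.
  by field; rewrite gt_eqF.
by rewrite EFinM lee_pmul2l.
Qed.

Lemma KL_f0 : KL f0 fbar = c%:E.
Proof.
have dh : is_density (fun z => fbar z * expR (q z - k)).
  by rewrite -f0E; exact: gauss_density.
rewrite f0E (@KL_tilt _ _ fbar q k (c + k) (gauss_density mz pK) fbar0 mq q0 k0 dh).
  by rewrite addrK.
(* The mean of [q] under [f0] is the cost already computed in [Jcost_f0_g0], divided by [lt]. *)
have -> : c + k = lt^-1 * (lt * (c + k)) by rewrite mulKf ?gt_eqF.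
rewrite EFinM -Jcost_f0_g0 /Jcost -intVZ ?invr_ge0 ?(ltW lt0)//; last 2 first.
- apply: mfunV_EFin; apply: measurable_funM; last exact: measV_gauss.
  apply: measurable_funM; first exact: measurable_cst.
  by apply: measV_cost; exact: measV_g0.
- by move=> z; rewrite lee_fin !mulr_ge0 ?sqnorm_ge0 ?gauss_pdf_ge0.
by apply: eq_intV => z; rewrite -EFinM f0_tilt /q; congr EFin; ring.
Qed.

Lemma ambiguity_f0 : ambiguity fbar c f0.
Proof. by split; [exact: gauss_density|rewrite KL_f0]. Qed.

End tilted.

(* Gibbs with the tilt [quad (K^-1) (z - mz) / 4], which turns [N(mz, K)] into a
   multiple of [N(mz, 2 K)]. *)
Lemma ambiguity_quad_fin N (mu : 'cV[R]_N) (K : 'M[R]_N) c f : posdef K ->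
  ambiguity (gauss_pdf mu K) c f ->
  (intV (fun z => (f z * (1 / 4 * quad (invmx K) (z - mu)))%:E) < +oo)%E.
Proof.
move=> pK af.
have mq : measV (fun z => 1 / 4 * quad (invmx K) (z - mu)).
  apply: measurable_funM; first exact: measurable_cst.
  rewrite /quad; under eq_fun do rewrite -mulmxA.
  have mF : mmap (fun t : N.-tuple R => tup2col t - mu).
    by apply: mmapB; [exact: mmap_tup2col|exact: mmap_cst].
  by apply: mmap_dot => //; exact: mmap_mulmx.
have q0 z : 0 <= 1 / 4 * quad (invmx K) (z - mu).
  by rewrite mulr_ge0// posdef_ge0//; exact: posdef_inv.
have p2 : posdef (2 *: K).
  case: pK => sK hK; split; first by rewrite linearZ /= sK.
  by move=> x x0; rewrite -/(quad _ _) quadZ mulr_gt0// hK.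
(* Ratio of the normalising constants of [N(mu, 2 K)] and [N(mu, K)]: the tilt halves the exponent
   [- quad / 2]. *)
pose M := Num.sqrt (\det (2 *: K)) / Num.sqrt (\det K).
have s2 : 0 < Num.sqrt (\det (2 *: K)) by rewrite sqrtr_gt0 posdef_det_gt0.
have M0 : 0 <= M by rewrite divr_ge0 ?sqrtr_ge0.
have hM : intV (fun z => (gauss_pdf mu K z * expR (1 / 4 * quad (invmx K) (z - mu) - 0))%:E) = M%:E.
  rewrite -[RHS]mule1 -(intV_gauss_pdf mu p2) -intVZ//; last 2 first.
  - by apply: mfunV_EFin; exact: measV_gauss.
  - by move=> z; rewrite lee_fin gauss_pdf_ge0.
  apply: eq_intV => z; rewrite -EFinM; congr EFin; rewrite /gauss_pdf -!/(quad _ _) subr0.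
  rewrite invmxZ ?posdef_unit// quadZ -[LHS]mulrA -expRD.
  have -> : - (1 / 2) * quad (invmx K) (z - mu) + 1 / 4 * quad (invmx K) (z - mu) =
    - (1 / 2) * (2^-1 * quad (invmx K) (z - mu)) by field.
  rewrite /M; move: (lt0r_neq0 s2).
  move: (Num.sqrt (\det (2 *: K))) (Num.sqrt (\det K))^-1 (Num.sqrt (2 * pi) ^- N) (expR _).
  move=> a b d u a0.
  by field.
have := gibbs_bound (gauss_density mu pK) (fun z => gauss_pdf_gt0 mu z pK) af mq q0 (lexx 0) hM.
by move=> /le_lt_trans; apply; exact: ltry.
Qed.

(** [g0] is affine in [y], so its square is bounded by a constant plus a multiple of the quadratic
    form that [ambiguity_quad_fin] integrates. *)
Lemma estimators_g0 (P : 'M[R]_p) c : posdef P ->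
  estimators (gauss_pdf mz (uschur G P S)) c g0.
Proof.
move=> pP; have pK : posdef (uschur G P S) by exact: posdef_uschur.
split; first exact: measV_g0.
move=> f af; have [[mf f_ge0 f1] _] := af.
set K := uschur G P S in pK af *.
pose E : 'M[R]_(p, p + m) := row_mx 0 G.
pose T := \tr (E *m K *m E^T).
have T0 : 0 <= T by exact: trace_quad.
pose Q z := 1 / 4 * quad (invmx K) (z - mz).
have Q0 z : 0 <= Q z by rewrite mulr_ge0// posdef_ge0//; exact: posdef_inv.
have mQ : measV Q.
  apply: measurable_funM; first exact: measurable_cst.
  rewrite /quad; under eq_fun do rewrite -mulmxA.
  have mF : mmap (fun t : (p + m).-tuple R => tup2col t - mz).
    by apply: mmapB; [exact: mmap_tup2col|exact: mmap_cst].
  by apply: mmap_dot => //; exact: mmap_mulmx.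
have Qfin := ambiguity_quad_fin pK af.
(* The factor 8 is 2 from [|x + y|^2 <= 2 |x|^2 + 2 |y|^2] times 4 from the [1 / 4] in [Q]. *)
have bound z : sqnorm (g0 (dsubmx z)) <= 2 * sqnorm mx + 8 * T * Q z.
  have h1 : sqnorm (E *m (z - mz)) <= T * quad (invmx K) (z - mz) by exact: sqnorm_le_quad.
  have h2 : E *m (z - mz) = G *m (dsubmx z - my).
    by rewrite -{1}(vsubmxK z) opp_col_mx add_col_mx mul_row_col mul0mx add0r.
  rewrite h2 in h1.
  have h3 (x y : 'cV[R]_p) : sqnorm (x + y) <= 2 * sqnorm x + 2 * sqnorm y.
    rewrite /sqnorm !mulr_sumr -big_split /=; apply: ler_sum => i _; rewrite mxE.
    by have := sqr_ge0 (x i 0 - y i 0); lra.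
  have := h3 mx (G *m (dsubmx z - my)); rewrite -/(g0 _) /Q; lra.
have sx0 := sqnorm_ge0 mx.
apply: (@le_lt_trans _ _ ((2 * sqnorm mx)%:E * intV (fun z => (f z)%:E) +
    (8 * T)%:E * intV (fun z => (f z * Q z)%:E))%E).
  have mfE := mfunV_EFin mf.
  have mfQ : mfunV (fun z => (f z * Q z)%:E) by apply: mfunV_EFin; exact: measurable_funM.
  have fQ0 z : 0 <= f z * Q z by rewrite mulr_ge0.
  rewrite -!intVZ ?mulr_ge0// -?intVD//.
  apply: le_intV.
  - apply: mfunV_EFin; apply: measurable_funM => //.
    under eq_fun do rewrite sqnormE.
    have mF : mmap (fun t : (p + m).-tuple R => g0 (dsubmx (tup2col t))).
      move=> i; apply: (measV_comp (measV_g0 i)).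
      by apply: mmap_dsubmx; exact: mmap_tup2col.
    exact: mmap_dot.
  - by apply: emeasurable_funD; apply: measurable_funeM.
  - by move=> z; rewrite lee_fin mulr_ge0 ?sqnorm_ge0.
  - move=> z; rewrite -!EFinM -EFinD lee_fin.
    by have := ler_wpM2r (f_ge0 z) (bound z); lra.
  - exact: measurable_funeM.
  - exact: measurable_funeM.
  - by move=> z; rewrite mule_ge0 ?lee_fin ?mulr_ge0.
  - by move=> z; apply: mule_ge0; rewrite lee_fin; [exact: mulr_ge0|exact: fQ0].
rewrite f1 mule1.
apply: lte_add_pinfty; first exact: ltry.
by apply: lte_mul_pinfty => //; rewrite lee_fin mulr_ge0.
Qed.

End saddle_point.

(** * The real spectral theorem *)

Lemma invmx_conj (F : fieldType) n (P D E : 'M[F]_n) : P \in unitmx -> D *m E = 1%:M ->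
  invmx (invmx P *m D *m P) = invmx P *m E *m P.
Proof.
move=> uP DE; have [uD _] := mulmx1_unit DE.
have uX : invmx P *m D *m P \in unitmx by rewrite !unitmx_mul unitmx_inv uP uD.
apply: (can_inj (mulKmx uX)); rewrite mulmxV// -!mulmxA mulKVmx//.
by rewrite (mulmxA D) DE mul1mx mulVmx.
Qed.

Lemma mxtrace_conj (F : fieldType) n (P D : 'M[F]_n) : P \in unitmx ->
  \tr (invmx P *m D *m P) = \tr D.
Proof. by move=> uP; rewrite -mulmxA mxtrace_mulC -mulmxA mulmxV// mulmx1. Qed.

Lemma det_conj (F : fieldType) n (P D : 'M[F]_n) : P \in unitmx ->
  \det (invmx P *m D *m P) = \det D.
Proof.
by move=> uP; rewrite !det_mulmx mulrAC -det_mulmx mulVmx// det1 mul1r.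
Qed.

Section real_spectral.
Import complex spectral sesquilinear.
Context {R : realType} (n : nat) (M : 'M[R]_n).
Hypothesis sM : M^T = M.
Local Notation C := (complex R).
Local Notation toC := (real_complex R : R -> C).
Let MC : 'M[C]_n := map_mx toC M.
Let P := spectralmx MC.

Let MC_herm : MC \is hermsymmx.
Proof.
apply/is_hermitianmxP; rewrite expr0 scale1r; apply/matrixP => i j.
rewrite !mxE -[in LHS]sM mxE.
by apply/esym/CrealP/complex_realP; exists (M j i).
Qed.

(** Eigenvalues with multiplicity, from the complex diagonalisation; [MC] is hermitian, so its
    diagonal is real and [Re] loses nothing. *)
Definition spectrum (i : 'I_n) : R := complex.Re (spectral_diag MC 0 i).

Let spectrumE i : toC (spectrum i) = spectral_diag MC 0 i.
Proof.
by apply: RRe_real; apply: (mxOverP (hermitian_spectral_diag_real MC_herm)).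
Qed.

(** Diagonalising [t - M] for every real [t] at once yields the determinant, the trace of the
    inverse and the quadratic form. Each identity then descends to the reals by injectivity of the
    embedding, without a real eigenbasis. *)
Let resolventE (t : R) : map_mx toC (t%:M - M) =
  invmx P *m diag_mx (\row_i toC (t - spectrum i)) *m P.
Proof.
have uP : P \in unitmx by exact: spectral_unit.
have -> : \row_i toC (t - spectrum i) = const_mx (toC t) - spectral_diag MC.
  by apply/rowP => i; rewrite !mxE rmorphB /= spectrumE.
rewrite [diag_mx _]linearB /= mulmxBr mulmxBl diag_const_mx mul_mx_scalar -scalemxAl mulVmx//.
rewrite -(orthomx_spectralP (hermitian_normalmx MC_herm)).
by rewrite map_mxB map_scalar_mx scalemx1.
Qed.

Lemma spectrum_det t : \det (t%:M - M) = \prod_i (t - spectrum i).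
Proof.
apply: (@complexI R); rewrite -det_map_mx resolventE det_conj ?spectral_unit//.
rewrite det_diag rmorph_prod /=.
by apply: eq_bigr => i _; rewrite mxE.
Qed.

Lemma spectrum_tr t : (forall i, t - spectrum i != 0) ->
  \tr (invmx (t%:M - M)) = \sum_i (t - spectrum i)^-1.
Proof.
move=> t0; apply: (@complexI R).
have -> : toC (\tr (invmx (t%:M - M))) = \tr (map_mx toC (invmx (t%:M - M))).
  by rewrite /mxtrace rmorph_sum /=; apply: eq_bigr => i _; rewrite mxE.
rewrite map_invmx resolventE.
pose E := diag_mx (\row_i toC (t - spectrum i)^-1).
set D := diag_mx _.
have DE : D *m E = 1%:M.
  rewrite mulmx_diag; apply/matrixP => i j; rewrite !mxE -rmorphM /= divff//.
rewrite (invmx_conj (spectral_unit MC) DE) mxtrace_conj ?spectral_unit//.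
rewrite mxtrace_diag rmorph_sum /=.
by apply: eq_bigr => i _; rewrite mxE.
Qed.

(** The weights are the squared moduli of the coordinates of [x] in the unitary eigenbasis. They are
    chosen before [t], so two values of [t] can be compared. *)
Lemma spectrum_quad (x : 'cV[R]_n) : exists2 w : 'I_n -> R, (forall i, 0 <= w i) &
  forall t, quad (t%:M - M) x = \sum_i (t - spectrum i) * w i.
Proof.
pose y := P *m map_mx toC x.
pose w i := complex.Re (`|y i 0| ^+ 2).
have wE i : toC (w i) = `|y i 0| ^+ 2.
  by apply: RRe_real; rewrite realX// normr_real.
exists w => [i|t]; first by rewrite -ler0c wE exprn_ge0.
apply: (@complexI R).
have -> : toC (quad (t%:M - M) x) =
    ((map_mx toC x)^T *m map_mx toC (t%:M - M) *m map_mx toC x) 0 0.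
  by rewrite /quad map_trmx -!map_mxM [RHS]mxE.
rewrite resolventE invmx_unitary ?spectral_unitarymx//.
(* A real vector equals its conjugate, so its transpose is its adjoint. *)
have -> : (map_mx toC x)^T = map_mx Num.conj (map_mx toC x)^T.
  apply/matrixP => i j; rewrite !mxE.
  by apply/esym/CrealP/complex_realP; exists (x j i).
rewrite !mulmxA -map_mxM -trmx_mul -!mulmxA -/y mxE rmorph_sum /=; clearbody y.
apply: eq_bigr => i _.
rewrite mul_diag_mx !mxE rmorphM /= wE normCK mulrCA (mulrC (y i 0)).
by [].
Qed.

Lemma eigenvalue_spectrum a : eigenvalue M a = [exists i, a == spectrum i].
Proof.
rewrite eigenvalue_root_char /root.
have -> : (char_poly M).[a] = \prod_i (a - spectrum i).
  rewrite -spectrum_det /char_poly -horner_evalE -det_map_mx; congr (\det _).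
  apply/matrixP => i j; rewrite !mxE rmorphB rmorphMn /= !horner_evalE.
  by rewrite hornerX hornerC.
apply/idP/existsP => [/prodf_eq0[i _]|[i /eqP ->]].
  by rewrite subr_eq0; exists i.
by apply/prodf_eq0; exists i; rewrite ?subrr.
Qed.

(** The set under the [sup] is the finite range of [spectrum], so the supremum is attained; [0 < n]
    makes the range nonempty. *)
Lemma lmax_spectrum : (0 < n)%N ->
  exists2 i0, lmax M = spectrum i0 & forall i, spectrum i <= lmax M.
Proof.
move=> n0.
pose i1 := Ordinal n0.
have [i0 _ hi0] : exists2 i0, true & forall i, spectrum i <= spectrum i0.
  case: (arg_maxP (P := xpredT) spectrum (i0 := i1) isT) => i0 _ h.
  by exists i0 => // i; exact: h.
have E : lmax M = spectrum i0.
  apply/eqP; rewrite eq_le; apply/andP; split.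
    apply: ge_sup.
      by exists (spectrum i0) => /=; rewrite eigenvalue_spectrum; apply/existsP; exists i0.
    by move=> a /=; rewrite eigenvalue_spectrum => /existsP[i /eqP ->].
  apply: ub_le_sup; last by rewrite /= eigenvalue_spectrum; apply/existsP; exists i0.
  exists (spectrum i0) => a /=.
  by rewrite eigenvalue_spectrum => /existsP[i /eqP ->].
by exists i0 => // i; rewrite E.
Qed.

End real_spectral.

(** * The dual function *)

Section dual_function.
Import numFieldNormedType.Exports.
Context {R : realType}.

(** Twice the divergence of [N(0, 1 / u)] from [N(0, 1)]. *)
Definition psi (u : R) : R := u^-1 - 1 + ln u.

Lemma ln_lt_subr1 (r : R) : 0 < r -> r != 1 -> ln r < r - 1.
Proof.
move=> r0 r1; have l0 : ln r != 0 by rewrite ln_eq0.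
by have := expR_gt1Dx l0; rewrite lnK ?posrE// ltrBrDl.
Qed.

Lemma ln_le_subr1 (r : R) : 0 < r -> ln r <= r - 1.
Proof.
move=> r0; have [->|r1] := eqVneq r 1; first by rewrite ln1 subrr.
exact/ltW/ln_lt_subr1.
Qed.

(* With [r = v / u]: [psi u - psi v = (r - 1) / v - ln r >= (r - 1) - ln r > 0]. *)
Lemma psi_decr (u v : R) : 0 < u -> u < v -> v <= 1 -> psi v < psi u.
Proof.
move=> u0 uv v1; have v0 : 0 < v by exact: lt_trans uv.
have r1 : 1 < v / u by rewrite ltr_pdivlMr// mul1r.
have := ln_lt_subr1 (lt_trans ltr01 r1) (negbT (gt_eqF r1)).
rewrite ln_div ?posrE// /psi => h.
suff : v / u - 1 <= u^-1 - v^-1 by lra.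
have -> : v / u - 1 = (u^-1 - v^-1) * v by field; rewrite !gt_eqF.
by rewrite ler_piMr// subr_ge0 lef_pV2 ?posrE// ltW.
Qed.

Lemma psi_ge0 (u : R) : 0 < u <= 1 -> 0 <= psi u.
Proof.
move=> /andP[u0]; rewrite le_eqVlt => /predU1P[->|u1].
  by rewrite /psi invr1 subrr ln1 addr0.
by have := psi_decr u0 u1 (lexx 1); rewrite {1}/psi invr1 subrr ln1 addr0 => /ltW.
Qed.

Lemma psi_le (u : R) : 0 < u <= 1 -> psi u <= u^-1 - 1.
Proof.
move=> /andP[u0 u1]; rewrite /psi gerDl; have := ln_le_subr1 u0; lra.
Qed.

(* [psi u = x - 1 - ln x] with [x = 1 / u], and [ln x = ln (x / 2) + ln 2 <= x / 2]. *)
Lemma psi_ge (u : R) : 0 < u -> u^-1 / 2 - 1 <= psi u.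
Proof.
move=> u0; have x0 : 0 < u^-1 / 2 by rewrite divr_gt0 ?invr_gt0.
have h1 := ln_le_subr1 x0.
have h2 : ln 2 <= 2 - 1 :> R by exact: ln_le_subr1.
have h3 : ln (u^-1 / 2) = - ln u - ln 2 by rewrite ln_div ?posrE ?invr_gt0// lnV.
rewrite h3 in h1; rewrite /psi; lra.
Qed.

Lemma continuous_psi (u : R) : 0 < u -> {for u, continuous psi}.
Proof.
move=> u0; apply: continuousD; last exact: continuous_ln.
apply: continuousB; last exact: cst_continuous.
by apply: continuousV; [rewrite gt_eqF|exact: cvg_id].
Qed.

Lemma continuous_sum_for (I : Type) (s : seq I) (f : I -> R -> R) (x : R) :
  (forall i, {for x, continuous (f i)}) ->
  {for x, continuous (fun y => \sum_(i <- s) f i y)}.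
Proof.
move=> cf; elim: s => [|a s IH].
  rewrite (_ : (fun _ => _) = fun=> 0); first exact: cst_continuous.
  by apply/funext => y; rewrite big_nil.
rewrite (_ : (fun _ => _) = fun y => f a y + \sum_(i <- s) f i y).
  exact: continuousD.
by apply/funext => y; rewrite big_cons.
Qed.

Variables (n : nat) (mu : 'I_n -> R) (i0 : 'I_n).
Hypothesis mu_gt0 : forall i, 0 < mu i.
Hypothesis mu_le : forall i, mu i <= mu i0.

Definition dualf (l : R) : R := 1 / 2 * \sum_i psi (1 - mu i / l).

Let arg_in l i : mu i0 < l -> 0 < 1 - mu i / l <= 1.
Proof.
move=> rl; have l0 : 0 < l by exact: lt_trans rl.
rewrite subr_gt0 ltr_pdivrMr// mul1r (le_lt_trans (mu_le i) rl)/=.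
by rewrite lerBlDr lerDl divr_ge0 ?ltW.
Qed.

Lemma dualf_decr l1 l2 : mu i0 < l1 -> l1 < l2 -> dualf l2 < dualf l1.
Proof.
move=> rl l12; have l10 : 0 < l1 by exact: lt_trans rl.
rewrite /dualf ltr_pM2l//.
apply: ltr_sum => [|i _]; first by apply/hasP; exists i0; rewrite ?mem_index_enum.
apply: psi_decr.
- by have /andP[] := arg_in i rl.
- by rewrite ltrD2l ltrN2 ltr_pM2l// ltf_pV2 ?posrE// (lt_trans l10).
- by have /andP[] := arg_in i (lt_trans rl l12).
Qed.

(** Only the term of the largest eigenvalue is kept, the others being nonnegative; it blows up at
    [mu i0] because [(1 - mu / l)^-1 = 1 + mu / (l - mu)]. *)
Lemma dualf_ge l : mu i0 < l -> 1 / 2 * (mu i0 / (l - mu i0) / 2 - 1) <= dualf l.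
Proof.
move=> rl; have l0 : 0 < l by exact: lt_trans rl.
rewrite /dualf ler_wpM2l//.
rewrite (bigD1 i0)//=; apply: (@le_trans _ _ (psi (1 - mu i0 / l))); last first.
  by rewrite lerDl sumr_ge0// => i _; apply: psi_ge0; exact: arg_in.
have /andP[a0 _] := arg_in i0 rl.
apply: le_trans (psi_ge a0); rewrite lerD2r ler_pM2r ?invr_gt0//.
have -> : (1 - mu i0 / l)^-1 = 1 + mu i0 / (l - mu i0).
  by field; rewrite !gt_eqF ?subr_gt0.
by rewrite lerDr.
Qed.

Lemma dualf_ge0 l : mu i0 < l -> 0 <= dualf l.
Proof.
move=> rl; rewrite mulr_ge0// sumr_ge0// => i _.
by apply: psi_ge0; exact: arg_in.
Qed.

Lemma dualf_le l : mu i0 < l -> dualf l <= n%:R * (mu i0 / (l - mu i0)).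
Proof.
move=> rl; have l0 : 0 < l by exact: lt_trans rl.
have d0 : 0 < l - mu i0 by rewrite subr_gt0.
have h : \sum_i psi (1 - mu i / l) <= \sum_(i < n) (mu i0 / (l - mu i0)).
  apply: ler_sum => i _; apply: le_trans (psi_le (arg_in i rl)) _.
  have di : 0 < l - mu i by rewrite subr_gt0 (le_lt_trans (mu_le i)).
  have -> : (1 - mu i / l)^-1 - 1 = mu i / (l - mu i).
    by field; rewrite !gt_eqF.
  rewrite ler_pM ?invr_ge0 ?(ltW di) ?(ltW (mu_gt0 i))//.
  by rewrite lef_pV2 ?posrE// lerD2l lerN2.
rewrite sumr_const card_ord -mulr_natl in h.
have := dualf_ge0 rl; rewrite /dualf; lra.
Qed.

Lemma dualf_cvgy : (dualf l @[l --> at_right (mu i0)] --> +oo).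
Proof.
have r0 := mu_gt0 i0.
apply/cvgryPge => A; pose a := `|A| + 1.
have a0 : 0 < a by rewrite ltr_wpDl.
near=> l.
have rl : mu i0 < l by near: l; exact: nbhs_right_gt.
have d0 : 0 < l - mu i0 by rewrite subr_gt0.
apply: le_trans (dualf_ge rl).
(* This forces [mu i0 / (l - mu i0) > 4 a], for which [dualf_ge] yields more than
   [a - 1/2 = |A| + 1/2]. *)
have : l - mu i0 < mu i0 / (4 * a).
  by near: l; apply: nbhs_right_ltDr; rewrite divr_gt0 ?mulr_gt0.
rewrite ltr_pdivlMr ?mulr_gt0// => h.
have : 4 * a < mu i0 / (l - mu i0) by rewrite ltr_pdivlMr// mulrC.
have := ler_norm A; rewrite /a; have := normr_ge0 A; lra.
Unshelve. all: by end_near. Qed.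

Lemma dualf_cvg0 : (dualf l @[l --> +oo] --> 0).
Proof.
have r0 := mu_gt0 i0.
apply/cvgrPdist_le => e e0.
have n0 : 0 < n%:R :> R by rewrite ltr0n (leq_ltn_trans _ (ltn_ord i0)).
near=> l.
(* The threshold at which the bound of [dualf_le] drops to [e]. *)
have hl : mu i0 + n%:R * mu i0 / e <= l by near: l; apply: nbhs_pinfty_ge; exact: num_real.
have h0 : 0 < n%:R * mu i0 / e by rewrite divr_gt0 ?mulr_gt0.
have rl : mu i0 < l by lra.
rewrite sub0r normrN ger0_norm ?dualf_ge0//.
apply: le_trans (dualf_le rl) _.
rewrite mulrA ler_pdivrMr ?subr_gt0// [leRHS]mulrC -ler_pdivrMr//.
by rewrite lerBrDl.
Unshelve. all: by end_near. Qed.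

Lemma continuous_dualf l : mu i0 < l -> {for l, continuous dualf}.
Proof.
move=> rl; have l0 : 0 < l by exact: lt_trans rl.
apply: continuousM; first exact: cst_continuous.
apply: continuous_sum_for => i.
suff : {for l, continuous (psi \o (fun y => 1 - mu i / y))} by [].
apply: continuous_comp; last first.
  by apply: continuous_psi; have /andP[] := arg_in i rl.
apply: continuousB; first exact: cst_continuous.
apply: continuousM; first exact: cst_continuous.
by apply: continuousV; [rewrite gt_eqF|exact: cvg_id].
Qed.

Lemma dualf_ex_unique c : 0 < c -> exists! l, mu i0 < l /\ dualf l = c.
Proof.
move=> c0.
have [a [ra ca]] : exists a, mu i0 < a /\ c < dualf a.
  have /cvgryPgt/(_ c) h := dualf_cvgy.
  have h2 := nbhs_right_gt (mu i0).
  by have [a [? ?]] := filter_ex (filterI h2 h); exists a.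
have [b [ab cb]] : exists b, a < b /\ dualf b < c.
  have /cvgrPdist_lt/(_ c c0) h := dualf_cvg0.
  have h2 := nbhs_pinfty_gt (num_real a).
  have [b [ab]] := filter_ex (filterI h2 h).
  rewrite sub0r normrN => hb; exists b; split => //.
  exact: le_lt_trans (ler_norm _) hb.
have cont : {within `[a, b], continuous dualf}.
  apply: continuous_in_subspaceT => x; rewrite inE /= in_itv /= => /andP[ax _].
  exact: continuous_dualf (lt_le_trans ra ax).
have [|l] := IVT (v := c) (ltW ab) cont.
  by rewrite ge_min le_max (ltW ca) (ltW cb) orbT.
rewrite in_itv /= => /andP[al _] hl.
exists l; split; first by split => //; exact: lt_le_trans al.
move=> l' [rl' hl'].
have rl : mu i0 < l by exact: lt_le_trans al.
have [hlt|hlt|//] := ltgtP l l'.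
- by have := dualf_decr rl hlt; rewrite hl hl' ltxx.
- by have := dualf_decr rl' hlt; rewrite hl hl' ltxx.
Qed.

End dual_function.

(** * The state-space model *)

Section sylvester.
Variables (F : fieldType) (p n : nat) (X : 'M[F]_(p, n)) (Y : 'M[F]_(n, p)).

(** Two block triangular factorisations of the matrix with rows [[1 X]] and [[Y 1]]. *)
Lemma det_sylvester : \det (1%:M - X *m Y) = \det (1%:M - Y *m X).
Proof.
have h1 : block_mx 1%:M X Y 1%:M = block_mx 1%:M 0 Y 1%:M *m block_mx 1%:M X 0 (1%:M - Y *m X).
  by rewrite mulmx_block !(mul1mx, mulmx1, mul0mx, mulmx0, addr0, add0r) addrC subrK.
have h2 : block_mx 1%:M X Y 1%:M = block_mx 1%:M X 0 1%:M *m block_mx (1%:M - X *m Y) 0 Y 1%:M.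
  by rewrite mulmx_block !(mul1mx, mulmx1, mul0mx, mulmx0, addr0, add0r) subrK.
have := congr1 (fun M => \det M) h1; rewrite h2 !det_mulmx !(det_ublock, det_lblock) !det1.
by rewrite !(mul1r, mulr1).
Qed.

(** Push-through identity: [(1 - X Y)^-1 = 1 + X (1 - Y X)^-1 Y]. Subtracting the identity inside
    each trace absorbs the difference between the sizes [p] and [n]. *)
Lemma trace_sylvester : 1%:M - Y *m X \in unitmx ->
  \tr (invmx (1%:M - X *m Y) - 1%:M) = \tr (invmx (1%:M - Y *m X) - 1%:M).
Proof.
move=> u; set J := invmx (1%:M - Y *m X).
have h : (1%:M - X *m Y) *m (1%:M + X *m J *m Y) = 1%:M.
  have e : (1%:M - X *m Y) *m X = X *m (1%:M - Y *m X).
    by rewrite mulmxBl mulmxBr mul1mx mulmx1 mulmxA.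
  by rewrite mulmxDr mulmx1 !mulmxA e mulmxK// subrK.
have [uX _] := mulmx1_unit h.
have -> : invmx (1%:M - X *m Y) = 1%:M + X *m J *m Y.
  by apply: (can_inj (mulKmx uX)); rewrite mulmxV// h.
rewrite addrAC subrr add0r -mulmxA mxtrace_mulC -mulmxA; congr (\tr _).
have e2 : Y *m X = 1%:M - (1%:M - Y *m X) by rewrite subKr.
by rewrite [in LHS]e2 mulmxBr mulmx1 mulVmx.
Qed.

End sylvester.

(** * Eigenvalues of [H P H^T]: positivity of the tilted covariance and the formula for the dual
    function *)

Section tilted_covariance.
Context {R : realType}.

Lemma quad1 n (x : 'cV[R]_n) : quad 1%:M x = sqnorm x.
Proof. by rewrite /quad mulmx1 sqnormE. Qed.

Lemma sqnorm_eq0 n (x : 'cV[R]_n) : sqnorm x = 0 -> x = 0.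
Proof.
move=> /eqP; rewrite psumr_eq0 => [/allP h|i _]; last exact: sqr_ge0.
apply/matrixP => i j; rewrite ord1 mxE.
by have := h i (mem_index_enum _); rewrite sqrf_eq0 => /eqP.
Qed.

Lemma lmax_lt_posdef n (M : 'M[R]_n) l : M^T = M -> (0 < n)%N -> lmax M < l ->
  posdef (l%:M - M).
Proof.
move=> sM n0 ll; split; first by rewrite linearB /= tr_scalar_mx sM.
move=> x x0; rewrite -/(quad _ _).
have [i0 _ hmax] := lmax_spectrum sM n0.
have [w w0 hw] := spectrum_quad sM x.
have d i : 0 < l - spectrum M i by rewrite subr_gt0 (le_lt_trans (hmax i)).
rewrite hw lt0r sumr_ge0 ?andbT => [|i _]; last by rewrite mulr_ge0// ltW.
apply: contra_neq x0 => /eqP.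
rewrite psumr_eq0 => [/allP h|i _]; last by rewrite mulr_ge0// ltW.
have {}h i : w i = 0.
  have := h i (mem_index_enum _); rewrite /= mulf_eq0 gt_eqF//= => /eqP //.
apply: sqnorm_eq0; rewrite -quad1.
(* The difference of [spectrum_quad] at [t = l + 1] and [t = l] expresses [|x|^2] as the sum of the
   weights, which all vanish. *)
have -> : 1%:M = ((l + 1)%:M - M) + -1 *: (l%:M - M) :> 'M[R]_n.
  by rewrite scaleN1r opprB addrA subrK raddfD /= addrC addKr.
by rewrite quadD quadZ !hw !big1 ?mulr0 ?addr0// => i _; rewrite h mulr0.
Qed.

Lemma posdef_spectrum_gt0 n (M : 'M[R]_n) i : posdef M -> 0 < spectrum M i.
Proof.
move=> [sM pM].
have : eigenvalue M (spectrum M i) by rewrite eigenvalue_spectrum//; apply/existsP; exists i.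
case/eigenvalueP => v hv v0.
have v0' : v^T != 0 by rewrite trmx_eq0.
have := pM _ v0'; rewrite trmxK hv -scalemxAl mxE.
have -> : (v *m v^T) 0 0 = sqnorm v^T by rewrite sqnormE trmxK.
have s0 : 0 < sqnorm v^T.
  by rewrite lt0r sqnorm_ge0 andbT; apply: contra_neq v0' => /sqnorm_eq0.
by rewrite pmulr_lgt0.
Qed.

Lemma ln_prod_gt0 n (f : 'I_n -> R) : (forall i, 0 < f i) ->
  ln (\prod_i f i) = \sum_i ln (f i).
Proof.
move=> f0; suff [] : 0 < \prod_i f i /\ ln (\prod_i f i) = \sum_i ln (f i) by [].
elim/big_rec2: _ => [|i y1 y2 _ [h1 h2]]; first by rewrite ln1.
by rewrite mulr_gt0// lnM ?posrE// h2.
Qed.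

Context (n p : nat) (H : 'M[R]_(n, p)) (P : 'M[R]_p).
Hypothesis pP : posdef P.
Let M := H *m P *m H^T.

Let sM : M^T = M.
Proof. by rewrite /M !trmx_mul trmxK (proj1 pP) mulmxA. Qed.

(* Cauchy-Schwarz for [v = H x]:
   [|v|^4 = ((H^T v).x)^2 <= quad M v * quad (P^-1) x < l |v|^2 quad (P^-1) x]. *)
Lemma posdef_tilt l : (0 < n)%N -> 0 < l -> lmax M < l ->
  posdef (invmx P - l^-1 *: (H^T *m H)).
Proof.
move=> n0 l0 ll; split.
  by rewrite linearB linearZ /= trmx_mul trmxK trmx_inv (proj1 pP).
move=> x x0; rewrite -/(quad _ _) quadD -scaleNr quadZ mulNr -[H^T]mulmx1 quad_mul quad1.
have q0 : 0 < quad (invmx P) x by have [_] := posdef_inv pP; apply.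
set v := H *m x; have [->|v0] := eqVneq v 0.
  by rewrite -quad1 quad0 mulr0 subr0.
have s0 : 0 < sqnorm v.
  by rewrite lt0r sqnorm_ge0 andbT; apply: contra_neq v0 => /sqnorm_eq0.
have := posdef_cauchy_schwarz (H^T *m v) x pP.
have -> : (((H^T *m v)^T *m x) 0 0) = sqnorm v by rewrite trmx_mul trmxK -mulmxA sqnormE.
have -> : quad P (H^T *m v) = quad M v by rewrite -quad_mul trmxK.
have hM : quad M v < l * sqnorm v.
  have [_ /(_ v v0)] := lmax_lt_posdef sM n0 ll.
  rewrite -/(quad _ _) quadD -scaleN1r quadZ mulN1r -scalemx1 quadZ quad1.
  by rewrite subr_gt0.
move=> h1; have h2 := ltr_pM2r q0 (quad M v) (l * sqnorm v); rewrite hM in h2.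
have {}h2 := le_lt_trans h1 h2.
rewrite subr_gt0 ltr_pdivrMl//.
by rewrite expr2 (mulrC l) -mulrA ltr_pM2l in h2.
Qed.

Lemma dual_eigenvalues l : (0 < n)%N -> 0 < l -> lmax M < l ->
  1 / 2 * (\tr (invmx (1%:M - l^-1 *: (H^T *m H *m P)) - 1%:M)
           + ln (\det (1%:M - l^-1 *: (H^T *m H *m P)))) = dualf (spectrum M) l.
Proof.
move=> n0 l0 ll; have ln0 : l != 0 by rewrite gt_eqF.
have [i0 _ hmax] := lmax_spectrum sM n0.
have d i : 0 < l - spectrum M i by rewrite subr_gt0 (le_lt_trans (hmax i)).
have d' i : l - spectrum M i != 0 by rewrite gt_eqF.
(* Split so that exchanging the factors replaces a nonsymmetric [p x p] product by the symmetric
   [l^-1 M]. *)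
have -> : l^-1 *: (H^T *m H *m P) = (l^-1 *: H^T) *m (H *m P).
  by rewrite -scalemxAl mulmxA.
have E : 1%:M - (H *m P) *m (l^-1 *: H^T) = l^-1 *: (l%:M - M).
  by rewrite -scalemxAr scalerBr scale_scalar_mx mulVf.
have uM : l%:M - M \in unitmx by apply: posdef_unit; exact: lmax_lt_posdef.
have uE : 1%:M - (H *m P) *m (l^-1 *: H^T) \in unitmx.
  by rewrite E unitmxE detZ unitrM -unitmxE uM unitrX// unitfE invr_eq0.
rewrite det_sylvester trace_sylvester// E detZ spectrum_det// raddfB /= mxtrace1.
rewrite invmxZ; last by rewrite -E.
rewrite invrK mxtraceZ spectrum_tr//.
rewrite /dualf; congr (_ * _).
have -> : l^-1 ^+ n * \prod_i (l - spectrum M i) = \prod_i (1 - spectrum M i / l).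
  have -> : l^-1 ^+ n = \prod_(i < n) l^-1 by rewrite prodr_const card_ord.
  by rewrite -big_split /=; apply: eq_bigr => i _; field.
have -> : n%:R = \sum_(i < n) (1 : R) by rewrite sumr_const card_ord.
rewrite ln_prod_gt0; last first.
  by move=> i; have -> : 1 - spectrum M i / l = (l - spectrum M i) / l; [field|rewrite divr_gt0].
rewrite mulr_sumr -sumrB -big_split /=.
apply: eq_bigr => i _; rewrite /psi; congr (_ - _ + _).
by field; rewrite d' ln0.
Qed.

End tilted_covariance.

(** * Nondegeneracy of the lifted model *)

Section state_space.
Context {R : realType}.

Lemma entE a b (M : 'M[R]_(a, b)) (i : 'I_a) (j : 'I_b) : ent M i j = M i j.
Proof. by rewrite /ent !valK. Qed.

Lemma ent_out a b (M : 'M[R]_(a, b)) (i j : nat) : (a <= i)%N -> ent M i j = 0.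
Proof. by move=> ai; rewrite /ent insubN// -leqNgt. Qed.

Lemma full_rank_inj m k (D : 'M[R]_(m, k)) (x : 'cV[R]_m) : \rank D = m ->
  D^T *m x = 0 -> x = 0.
Proof.
move=> rD /(congr1 trmx); rewrite trmx_mul trmxK trmx0 => /eqP.
rewrite mulmx_free_eq0 ?/row_free ?rD// => /eqP h.
by rewrite -[x]trmxK h trmx0.
Qed.

Lemma quad_sandwich a b (A : 'M[R]_(a, b)) K x : quad (A *m K *m A^T) x = quad K (A^T *m x).
Proof. by rewrite -quad_mul trmxK. Qed.

Lemma quad_gram a b (A : 'M[R]_(a, b)) x : quad (A *m A^T) x = sqnorm (A^T *m x).
Proof. by rewrite -[X in X *m A^T]mulmx1 quad_sandwich quad1. Qed.

Lemma tr_sandwich a b (A : 'M[R]_(a, b)) K : K^T = K -> (A *m K *m A^T)^T = A *m K *m A^T.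
Proof. by move=> sK; rewrite !trmx_mul trmxK sK mulmxA. Qed.

Lemma tr_gram a b (A : 'M[R]_(a, b)) : (A *m A^T)^T = A *m A^T.
Proof. by rewrite trmx_mul trmxK. Qed.

Lemma posdef_innovation p m k (C : 'M[R]_(m, p)) (D : 'M[R]_(m, k)) V :
  posdef V -> \rank D = m -> posdef (C *m V *m C^T + D *m D^T).
Proof.
move=> pV rD; split; first by rewrite linearD /= tr_sandwich ?tr_gram// (proj1 pV).
move=> x x0; rewrite -/(quad _ _) quadD quad_sandwich quad_gram.
rewrite ltr_wpDl ?posdef_ge0// lt0r sqnorm_ge0 andbT.
by apply: contra_neq x0 => /sqnorm_eq0; exact: full_rank_inj.
Qed.

(* Joseph form:
   [P = (A - G C) V (A - G C)^T + G D D^T G^T + B B^T]. *)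
Lemma posdef_riccati p m k (A : 'M[R]_p) (B : 'M[R]_(p, k)) (C : 'M[R]_(m, p))
    (D : 'M[R]_(m, k)) V : posdef V -> \rank D = m ->
  (forall x : 'cV_p, A^T *m x = 0 -> B^T *m x = 0 -> x = 0) ->
  let S := C *m V *m C^T + D *m D^T in
  let G := A *m V *m C^T *m invmx S in
  posdef (A *m V *m A^T - G *m S *m G^T + B *m B^T).
Proof.
move=> pV rD inj S G; have pS : posdef S by exact: posdef_innovation.
have GS : G *m S = A *m V *m C^T by rewrite mulmxKV// posdef_unit.
have sSG : G *m S *m G^T = G *m C *m V *m A^T.
  rewrite -(tr_sandwich G (proj1 pS)) GS !trmx_mul !trmxK (proj1 pV).
  by rewrite !mulmxA.
have DD : D *m D^T = S - C *m V *m C^T by rewrite /S addrC addKr.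
clearbody G; clearbody S.
have E : A *m V *m A^T - G *m S *m G^T =
    (A - G *m C) *m V *m (A - G *m C)^T + G *m (D *m D^T) *m G^T.
  rewrite DD [(A - G *m C)^T]linearB /= trmx_mul !mulmxBr !mulmxBl !mulmxA -GS -sSG.
  by rewrite subrK.
rewrite E; split.
  rewrite [LHS]linearD /= [X in X + _ = _]linearD /= tr_gram.
  by rewrite (tr_sandwich _ (proj1 pV)) (tr_sandwich _ (tr_gram D)).
move=> x x0; rewrite -/(quad _ _) !quadD !quad_sandwich !quad_gram.
set a := quad V _; set b := sqnorm _; set d := sqnorm _.
have a0 : 0 <= a by exact: posdef_ge0.
have b0 : 0 <= b by exact: sqnorm_ge0.
have d0 : 0 <= d by exact: sqnorm_ge0.
rewrite lt0r !addr_ge0// andbT; apply: contra_neq x0 => /eqP.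
rewrite !paddr_eq0 ?addr_ge0// => /andP[/andP[/eqP za /eqP zb] /eqP zd].
(* Full row rank of [D] turns the vanishing [D D^T] term into [G^T x = 0]; the [V] term then reduces
   to [A^T x = 0]. *)
have Gx : G^T *m x = 0 by apply: full_rank_inj rD _; exact: sqnorm_eq0.
apply: inj; last exact: sqnorm_eq0.
have := posdef_eq0 pV za.
by rewrite linearB /= trmx_mul mulmxBl -mulmxA Gx mulmx0 subr0.
Qed.

Context (n L : nat).

(** [Bt^T x = 0] kills the first block of [x], as [B] has full row rank. For [k >= n], entry [k - n]
    of [At^T x] is [x k] plus a combination of first-block entries, so every other block vanishes
    too. *)
Lemma lift_inj m (A : 'M[R]_n) (B : 'M[R]_(n, n + m)) (x : 'cV[R]_(L.+1 * n)) :
  \rank B = n -> (At L A)^T *m x = 0 -> (Bt L B)^T *m x = 0 -> x = 0.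
Proof.
move=> rB Ax Bx.
have np : (n <= L.+1 * n)%N by rewrite mulSn leq_addr.
have xtop (i : 'I_(L.+1 * n)) : (i < n)%N -> x i 0 = 0.
  move=> lin; pose y : 'cV[R]_n := \col_k ent x k 0.
  suff y0 : y = 0.
    have := congr1 (fun M : 'cV[R]_n => M (Ordinal lin) 0) y0.
    by rewrite !mxE /= (entE x i 0).
  apply: full_rank_inj rB _; apply/matrixP => j k; rewrite ord1 [RHS]mxE.
  have := congr1 (fun M : 'cV[R]_(n + m) => M j 0) Bx; rewrite [RHS]mxE => <-.
  rewrite !mxE.
  transitivity (\sum_(k0 < n) ent B k0 j * ent x k0 0).
    by apply: eq_bigr => k0 _; rewrite !mxE entE.
  rewrite (big_ord_widen _ (fun k0 => ent B k0 j * ent x k0 0) np) big_mkcond /=.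
  apply: eq_bigr => k0 _; rewrite !mxE (entE x k0 0).
  by case: ltnP => // h; rewrite ent_out// mul0r.
apply/matrixP => k j; rewrite (ord1 j) [RHS]mxE {j}.
case: (ltnP k n) => [/xtop//|nk].
have kn : (k - n < L.+1 * n)%N by exact: leq_ltn_trans (leq_subr _ _) (ltn_ord k).
have := congr1 (fun M : 'cV[R]_(L.+1 * n) => M (Ordinal kn) 0) Ax; rewrite [RHS]mxE => <-.
rewrite mxE (bigD1 k)//= !mxE ltnNge nk /= subnK// eqxx mul1r big1 ?addr0// => i ik.
case: (ltnP i n) => [/xtop ->|ni]; first by rewrite mulr0.
rewrite !mxE ltnNge ni /= subnK// (_ : (i : nat) == k = false) ?mul0r//.
exact/negbTE.
Qed.

(** Makes [Ht P Ht^T] positive definite, so that all its eigenvalues are positive, as the section on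
    the dual function assumes. *)
Lemma Ht_inj (x : 'cV[R]_n) : (Ht n L)^T *m x = 0 -> x = 0.
Proof.
move=> Hx; apply/matrixP => i j; rewrite (ord1 j) [RHS]mxE {j}.
have h : (i + L * n < L.+1 * n)%N by rewrite mulSn ltn_add2r.
have := congr1 (fun M : 'cV[R]_(L.+1 * n) => M (Ordinal h) 0) Hx; rewrite [RHS]mxE => <-.
rewrite mxE (bigD1 i)//= !mxE /= eqxx mul1r big1 ?addr0// => k ki.
rewrite !mxE /= eqn_add2r (_ : (i : nat) == k = false) ?mul0r//.
by apply/negbTE; rewrite eq_sym.
Qed.

Lemma BtD0 m (B : 'M[R]_(n, n + m)) (D : 'M[R]_(m, n + m)) : B *m D^T = 0 ->
  Bt L B *m D^T = 0.
Proof.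
move=> BD; apply/matrixP => i j; rewrite [RHS]mxE mxE.
case: (ltnP i n) => [lin|ni].
  have := congr1 (fun M : 'M[R]_(n, m) => M (Ordinal lin) j) BD; rewrite [RHS]mxE mxE => h.
  rewrite -[RHS]h; apply: eq_bigr => k _; rewrite [Bt _ _ _ _]mxE; congr (_ * _).
  exact: (entE B (Ordinal lin) k).
by apply: big1 => k _; rewrite [Bt _ _ _ _]mxE ent_out// mul0r.
Qed.

End state_space.

(** With [B D^T = 0] the cross covariance is [A V C^T], which equals [G S] by the choice of the
    gain; the Riccati expression is then the Schur complement of [S]. *)
Lemma joint_covariance (R : realType) p m k (A : 'M[R]_p) (B : 'M[R]_(p, k))
    (C : 'M[R]_(m, p)) (D : 'M[R]_(m, k)) V :
  V^T = V -> B *m D^T = 0 ->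
  let S := C *m V *m C^T + D *m D^T in
  let G := A *m V *m C^T *m invmx S in
  S \in unitmx ->
  col_mx A C *m V *m (col_mx A C)^T + col_mx B D *m (col_mx B D)^T =
  uschur G (A *m V *m A^T - G *m S *m G^T + B *m B^T) S.
Proof.
move=> sV BD S G uS.
have GS : G *m S = A *m V *m C^T by rewrite mulmxKV.
have sS : S^T = S by rewrite linearD /= tr_sandwich ?tr_gram.
have SG : S *m G^T = C *m V *m A^T.
  by rewrite -[S in LHS]sS -trmx_mul GS !trmx_mul trmxK sV mulmxA.
have DB : D *m B^T = 0 by rewrite -[D]trmxK -trmx_mul BD trmx0.
rewrite uschurE GS SG !tr_col_mx (mul_col_mx A C V) !mul_col_row add_block_mx BD DB !addr0.
by rewrite -GS addrAC subrK.
Qed.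

Unset Implicit Arguments.

Theorem theorem1 (R : realType) (n m L : nat)
  (A : 'M[R]_n) (B : 'M[R]_(n, n + m)) (C : 'M[R]_(m, n)) (D : 'M[R]_(m, n + m))
  (hn : (0 < n)%N)
  (hBD : B *m D^T = 0) (hB : \rank B = n) (hD : \rank D = m)
  (xihat : 'cV[R]_(L.+1 * n)) (V : 'M[R]_(L.+1 * n)) (c : R)
  (hV : posdef V) (hc : 0 < c) :
  let At := At L A in
  let Bt := Bt L B in
  let Ct := Ct L C in
  let Ht := Ht n L in
  let S := Ct *m V *m Ct^T + D *m D^T in
  let G := At *m V *m Ct^T *m invmx S in
  let P := At *m V *m At^T - G *m S *m G^T + Bt *m Bt^T in
  let g0 := fun y : 'cV[R]_m => At *m xihat + G *m (y - Ct *m xihat) in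
  let mz := col_mx At Ct *m xihat in
  let Kz := col_mx At Ct *m V *m (col_mx At Ct)^T + col_mx Bt D *m (col_mx Bt D)^T in
  let fbar := gauss_pdf mz Kz in
  let rP := lmax (Ht *m P *m Ht^T) in
  let gam := fun l : R =>
    (1 / 2) * (\tr (invmx (1%:M - l^-1 *: (Ht^T *m Ht *m P)) - 1%:M)
               + ln (\det (1%:M - l^-1 *: (Ht^T *m Ht *m P)))) in
  (* (i) *)
  ((forall l1 l2, rP < l1 -> l1 < l2 -> gam l2 < gam l1)
   /\ ((gam l)%:E @[l --> at_right rP] --> +oo%E)
   /\ (gam l @[l --> +oo] --> 0)
   /\ (exists! l, rP < l /\ gam l = c))
  /\
  (forall lt, rP < lt -> gam lt = c ->
     let V1 := invmx (invmx P - lt^-1 *: (Ht^T *m Ht)) in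
     let K0 := block_mx 1%:M G 0 1%:M *m block_mx V1 0 0 S
               *m block_mx 1%:M 0 G^T 1%:M in
     let f0 := gauss_pdf mz K0 in
     (* (ii) *)
     [/\ posdef V1,
         (ambiguity fbar c f0 /\ KL f0 fbar = c%:E),
         posdef K0 /\ estimators fbar c g0,
         (forall f, ambiguity fbar c f -> (Jcost Ht f g0 <= Jcost Ht f0 g0)%E)
         & (forall g, estimators fbar c g -> (Jcost Ht f0 g0 <= Jcost Ht f0 g)%E)]
     /\
     (* (iii) *)
     (forall y : 'cV[R]_m,
        [/\ (0 < marg f0 y < +oo)%E,
            (forall x, cond_density f0 y x = gauss_pdf (g0 y) V1 x),
            (0 < marg fbar y < +oo)%E
          & (forall x, cond_density fbar y x = gauss_pdf (g0 y) P x)])).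

Proof.
move=> At' Bt' Ct' Ht' S G P g0 mz Kz fbar rP gam.
have pS : posdef S by exact: posdef_innovation.
have pP : posdef P.
  by apply: posdef_riccati => // x; exact: lift_inj.
have uS := posdef_unit pS.
have EK : Kz = uschur G P S.
  by apply: joint_covariance => //; [exact: (proj1 hV)|exact: BtD0].
have Emz : mz = col_mx (At' *m xihat) (Ct' *m xihat) by rewrite /mz mul_col_mx.
pose M := Ht' *m P *m Ht'^T.
have pM : posdef M.
  have -> : M = Ht'^T^T *m P *m Ht'^T by rewrite trmxK.
  by apply: posdef_congr => // x; exact: Ht_inj.
have [i0 Er hmax] := lmax_spectrum (proj1 pM) hn.
have mu0 i := posdef_spectrum_gt0 i pM.
have hle i : spectrum M i <= spectrum M i0 by rewrite -Er.
have rP0 : 0 < rP by rewrite /rP -/M Er.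
have rPE : rP = spectrum M i0 by exact: Er.
have gamE l : rP < l -> gam l = dualf (spectrum M) l.
  by move=> rl; apply: dual_eigenvalues => //; exact: lt_trans rl.
split.
- split; [|split; [|split]].
  + move=> l1 l2 r1 l12; rewrite (gamE _ r1) (gamE _ (lt_trans r1 l12)).
    by apply: (dualf_decr mu0 hle) => //; rewrite -rPE.
  + apply/cvgeryP.
    have h := dualf_cvgy mu0 hle; rewrite -rPE in h.
    (* [gam] and [dualf] are known to agree only beyond [rP], which is enough along this filter and
       along the one at infinity. *)
    apply: cvg_trans h; apply: near_eq_cvg.
    near=> l; apply/esym/gamE; near: l; exact: nbhs_right_gt.
  + apply: cvg_trans (dualf_cvg0 mu0 hle); apply: near_eq_cvg.
    near=> l; apply/esym/gamE; near: l; apply: nbhs_pinfty_gt; exact: num_real.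
  + have [l [[rl hl] hu]] := dualf_ex_unique mu0 hle hc.
    rewrite -rPE in rl hu; exists l; split; first by rewrite gamE.
    by move=> l' [rl' hl']; apply: hu; rewrite -gamE.
- move=> lt rlt hlt V1 K0 f0.
  have lt0 : 0 < lt by exact: lt_trans rlt.
  have pV1 : posdef V1 by apply: posdef_inv; exact: posdef_tilt.
  have EK0 : K0 = uschur G V1 S by [].
  have pK0 : posdef K0 by rewrite EK0; exact: posdef_uschur.
  have Ef : fbar = gauss_pdf (col_mx (At' *m xihat) (Ct' *m xihat)) (uschur G P S).
    by rewrite /fbar EK Emz.
  have Ef0 : f0 = gauss_pdf (col_mx (At' *m xihat) (Ct' *m xihat)) (uschur G V1 S).
    by rewrite /f0 EK0 Emz.
  split.
    split => //.
    + by rewrite Ef Ef0; split; [exact: ambiguity_f0|exact: KL_f0].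
    + by split => //; rewrite Ef; exact: estimators_g0.
    + by move=> f; rewrite Ef Ef0; exact: Jcost_g0_le.
    + by move=> g [mg _]; rewrite Ef0; exact: Jcost_f0_ge.
  move=> y; rewrite Ef Ef0; split.
  + exact: marg_gauss_fin.
  + by move=> x; exact: cond_density_gauss.
  + exact: marg_gauss_fin.
  + by move=> x; exact: cond_density_gauss.
Unshelve. all: by end_near. Qed.
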